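(* Let $(R,D)$ be a second-order regular overdetermined system of codimension $2$ with $2$ independent and $1$ dependent variables, of one of the types (I), (II), (III), (IV). Then only the involutive systems (i.e. those of type (I)) have a non-trivial rank $2$ prolongation $\Sigma(R)$; that is, the projection $p:\Sigma(R)\to R$ identifies $\Sigma(R)$ with $R$ (exactly one $2$-dimensional integral element at each point) when $(R,D)$ is of type (II), (III) or (IV), and it does not when $(R,D)$ is of type (I). Moreover, when $(R,D)$ is of type (I), the rank $2$ prolongation $\Sigma(R)$ is an $S^1$-bundle over $R$ (with projection $p$).
   Context: Let $J^1(\mathbb R^2,\mathbb R)=\{(x,y,z,p,q)\}$, $J^2(\mathbb R^2,\mathbb R)=\{(x,y,z,p,q,r,s,t)\}$, let $\pi^2_1:J^2\to J^1$ be the natural projection, and let $C^2$ be the canonical system on $J^2$ defined by $\varpi_0=\varpi_1=\varpi_2=0$ with $\varpi_0=dz-p\,dx-q\,dy$, $\varpi_1=dp-r\,dx-s\,dy$, $\varpi_2=dq-s\,dx-t\,dy$. A second-order regular overdetermined system (codimension $2$, with $2$ independent and $1$ dependent variables) is a non-empty subset $R=\{F=G=0\}\subset J^2$, with $F,G$ smooth, such that $(F_r,F_s,F_t)$ and $(G_r,G_s,G_t)$ are linearly independent on $R$, together with $D=C^2|_R$. Then $R$ is a $6$-dimensional manifold, $\pi^2_1|_R:R\to J^1$ is a submersion, and $D$ is a rank $3$ subbundle of $TR$. Types. $(R,D)$ is of type (I), (II), (III) or (IV) if around every $w\in R$ there is a coframe $\{\varpi_0,\varpi_1,\varpi_2,\omega_1,\omega_2,\pi\}$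 of $R$, with $\varpi_0$ the restriction to $R$ of $dz-p\,dx-q\,dy$ and $D=\{\varpi_0=\varpi_1=\varpi_2=0\}$, such that at $w$ one has $d\varpi_0\equiv\omega_1\wedge\varpi_1+\omega_2\wedge\varpi_2 \pmod{\varpi_0}$ and, modulo $\varpi_0,\varpi_1,\varpi_2$: (I) (involutive type) $d\varpi_1\equiv 0$, $d\varpi_2\equiv\omega_2\wedge\pi$; (II) (finite type) $d\varpi_1\equiv\omega_2\wedge\pi$, $d\varpi_2\equiv\omega_1\wedge\pi$; (III) (finite type) $d\varpi_1\equiv\omega_1\wedge\pi$, $d\varpi_2\equiv\omega_2\wedge\pi$; (IV) (torsion type) $d\varpi_1\equiv\omega_1\wedge\omega_2$, $d\varpi_2\equiv\omega_2\wedge\pi$. Rank $2$ prolongation. For a differential system $D=\{\theta_1=\dots=\theta_s=0\}$ on a manifold $R$, a $2$-dimensional integral element of $D$ at $x\in R$ is a $2$-dimensional subspace $v\subset D(x)$ with $d\theta_i|_v=0$ for all $i$. The rank $2$ prolongation is $\Sigma(R)=\bigcup_{x\in R}\Sigma_x$, where $\Sigma_x$ is the set of $2$-dimensional integral elements of $D$ at $x$; it is a subset of the Grassmann bundle $J(D,2)$ of $2$-dimensional subspaces of the fibres of $D$, and $p:\Sigma(R)\to R$ is the projection. *)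

(* Defs.v *)
From HB Require Import structures.
From mathcomp Require Import all_boot all_order all_algebra.
From mathcomp Require Import all_classical all_reals all_analysis.

Set Implicit Arguments.
Unset Strict Implicit.
Unset Printing Implicit Defensive.

Import Order.TTheory GRing.Theory Num.Theory.
Import numFieldNormedType.Exports.

Local Open Scope classical_set_scope.
Local Open Scope ring_scope.

Section Smooth.
Context {R : realType}.
Implicit Types V W : normedModType R.

Definition iter_derive V W (s : seq V) (f : V -> W) : V -> W :=
  foldr (fun v g x => 'D_v g x) f s.

(* C^oo on U, for U open and V, W finite-dimensional: every iterated partial
   derivative is differentiable, hence continuous, at every point of U. *)
Definition smooth_on V W (U : set V) (f : V -> W) : Prop :=
  forall (s : seq V) (x : V), U x -> differentiable (iter_derive s f) x.

(* Smoothness of a map on an arbitrary subset of a Euclidean space: it has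
   local smooth extensions. On embedded submanifolds this is the usual notion. *)
Definition smooth_map V W (A : set V) (f : V -> W) : Prop :=
  forall x, A x -> exists (U : set V) (g : V -> W),
    [/\ open_nbhs x U, smooth_on U g & forall y, (A `&` U) y -> g y = f y].

Definition diffeomorphism V W (A : set V) (B : set W) (f : V -> W) : Prop :=
  exists g : W -> V,
    [/\ smooth_map A f, smooth_map B g,
        (forall x, A x -> B (f x) /\ g (f x) = x) &
        (forall y, B y -> A (g y) /\ f (g y) = y)].

(* p : E -> B is a smooth locally trivial bundle with typical fibre S. *)
Definition smooth_bundle (VE VB VS : normedModType R) (S : set VS) (E : set VE) (B : set VB)
    (p : VE -> VB) : Prop :=
  [/\ (forall e, E e -> B (p e)), smooth_map E p &
      forall b, B b -> exists (U : set VB) (Phi : (VB * VS)%type -> VE),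
        [/\ open_nbhs b U,
            diffeomorphism ((B `&` U) `*` S) (E `&` p @^-1` U) Phi &
            forall z, ((B `&` U) `*` S) z -> p (Phi z) = z.1]].

Definition circle : set 'rV[R]_2 :=
  [set u | u 0 0 ^+ 2 + u 0 1 ^+ 2 = 1].

End Smooth.

Variant systype := TypeI | TypeII | TypeIII | TypeIV.

Section Jets.
Context {R : realType}.

(* J^2(R^2,R) is modelled on 'rV[R]_8, with coordinates (x,y,z,p,q,r,s,t) in
   this order. *)
Definition ix : 'I_8 := @Ordinal 8 0 isT.
Definition iy : 'I_8 := @Ordinal 8 1 isT.
Definition iz : 'I_8 := @Ordinal 8 2 isT.
Definition ip : 'I_8 := @Ordinal 8 3 isT.
Definition iq : 'I_8 := @Ordinal 8 4 isT.
Definition ir : 'I_8 := @Ordinal 8 5 isT.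
Definition is_ : 'I_8 := @Ordinal 8 6 isT.
Definition it : 'I_8 := @Ordinal 8 7 isT.

Definition unitv (i : 'I_8) : 'rV[R]_8 := delta_mx 0 i.

(* A covector is given by its coefficients on dx, dy, ..., dt, and a 1-form by
   its coefficient functions. *)
Definition ev (a v : 'rV[R]_8) : R := \sum_i a 0 i * v 0 i.

Definition form1 : Type := 'rV[R]_8 -> 'rV[R]_8.

Definition wedge (a b : 'rV[R]_8) (u v : 'rV[R]_8) : R :=
  ev a u * ev b v - ev a v * ev b u.

Definition extd (a : form1) (x u v : 'rV[R]_8) : R :=
  ev ('D_u a x) v - ev ('D_v a x) u.

(* dz - p dx - q dy, dp - r dx - s dy, dq - s dx - t dy *)
Definition varpi0 : form1 := fun w =>
  unitv iz - w 0 ip *: unitv ix - w 0 iq *: unitv iy.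
Definition varpi1 : form1 := fun w =>
  unitv ip - w 0 ir *: unitv ix - w 0 is_ *: unitv iy.
Definition varpi2 : form1 := fun w =>
  unitv iq - w 0 is_ *: unitv ix - w 0 it *: unitv iy.

(* Fibre at w of the system defined on T by the vanishing of the forms th. *)
Definition pfaff (T : 'rV[R]_8 -> set 'rV[R]_8) (th : seq form1)
    (w : 'rV[R]_8) : set 'rV[R]_8 :=
  [set v | T w v /\ forall i, (i < size th)%N -> ev (nth (fun=> 0) th i w) v = 0].

(* Congruence, as 2-forms on the subspace T, modulo the ideal generated by the
   covectors th: the difference is a sum of terms eta_i /\ th_i. *)
Definition eqmod2 (T : set 'rV[R]_8) (th : seq 'rV[R]_8)
    (a b : 'rV[R]_8 -> 'rV[R]_8 -> R) : Prop :=
  exists eta : 'I_(size th) -> 'rV[R]_8, forall u v, T u -> T v ->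
    a u v - b u v = \sum_i wedge (eta i) (nth 0 th i) u v.

(* The restrictions to T of the covectors th form a basis of the dual of T
   (every linear form on T is the restriction of some covector xi). *)
Definition dual_basis (T : set 'rV[R]_8) (th : seq 'rV[R]_8) : Prop :=
  forall xi : 'rV[R]_8, exists! c : 'rV[R]_(size th),
    forall v, T v -> ev xi v = \sum_i c 0 i * ev (nth 0 th i) v.

(* Integral elements of dimension 2 at w of the system {th = 0} on the
   submanifold with tangent spaces T; restricting to the submanifold commutes
   with exterior differentiation. *)
Definition integral_element2 (T : 'rV[R]_8 -> set 'rV[R]_8) (th : seq form1)
    (w : 'rV[R]_8) (V : {vspace 'rV[R]_8}) : Prop :=
  [/\ \dim V = 2%N,
      (forall v, v \in V -> pfaff T th w v) &
      forall i, (i < size th)%N -> forall u v, u \in V -> v \in V ->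
        extd (nth (fun=> 0) th i) w u v = 0].

(* Matrix of the orthogonal projection onto V, acting on row vectors. The map
   V |-> orthproj V is a smooth embedding of each Grassmannian of R^8 into the
   8 x 8 matrices. *)
Definition orthproj (V : {vspace 'rV[R]_8}) : 'M[R]_8 :=
  let B : 'M[R]_(\dim V, 8) := \matrix_(i < \dim V) (vbasis V)`_i in
  B^T *m invmx (B *m B^T) *m B.

Definition grass_embed (e : 'rV[R]_8 * {vspace 'rV[R]_8}) :
  ('rV[R]_8 * 'M[R]_8)%type := (e.1, orthproj e.2).

Section System.
Variables F G : 'rV[R]_8 -> R.

Definition locus : set 'rV[R]_8 := [set w | F w = 0 /\ G w = 0].

Definition symbol_rows (w : 'rV[R]_8) : 'M[R]_(2, 3) :=
  \matrix_(i < 2, j < 3)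
    'D_(unitv (nth ir [:: ir; is_; it] j)) (nth F [:: F; G] i) w.

Definition regular_overdetermined : Prop :=
  [/\ smooth_on setT F, smooth_on setT G, locus !=set0 &
      forall w, locus w -> row_free (symbol_rows w)].

Definition tangent (w : 'rV[R]_8) : set 'rV[R]_8 :=
  [set v | 'D_v F w = 0 /\ 'D_v G w = 0].

(* D = C^2 restricted to the locus *)
Definition Dsys : 'rV[R]_8 -> set 'rV[R]_8 :=
  pfaff tangent [:: varpi0; varpi1; varpi2].

(* Right-hand sides of the structure equations for d varpi_1, d varpi_2. *)
Definition structure_eq1 (k : systype) (o1 o2 p : 'rV[R]_8) :=
  match k with
  | TypeI => fun _ _ => 0
  | TypeII => wedge o2 p
  | TypeIII => wedge o1 p
  | TypeIV => wedge o1 o2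
  end.

Definition structure_eq2 (k : systype) (o1 o2 p : 'rV[R]_8) :=
  match k with
  | TypeI => wedge o2 p
  | TypeII => wedge o1 p
  | TypeIII => wedge o2 p
  | TypeIV => wedge o2 p
  end.

(* The forms a1, a2, o1, o2, p of the coframe are smooth on a neighbourhood of
   w in J^2 and only their restrictions to the locus matter; locally, every
   smooth form on the locus is such a restriction. *)
Definition of_type (k : systype) : Prop :=
  forall w, locus w ->
  exists (U : set 'rV[R]_8) (a1 a2 o1 o2 p : form1),
  [/\ open_nbhs w U,
      [/\ smooth_on U a1, smooth_on U a2, smooth_on U o1, smooth_on U o2 &
          smooth_on U p],
      (forall x, locus x -> U x ->
         dual_basis (tangent x)
           [:: varpi0 x; a1 x; a2 x; o1 x; o2 x; p x]),
      (forall x, locus x -> U x ->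
         Dsys x = pfaff tangent [:: varpi0; a1; a2] x) &
      [/\ eqmod2 (tangent w) [:: varpi0 w] (extd varpi0 w)
            (fun u v => wedge (o1 w) (a1 w) u v + wedge (o2 w) (a2 w) u v),
          eqmod2 (tangent w) [:: varpi0 w; a1 w; a2 w] (extd a1 w)
            (structure_eq1 k (o1 w) (o2 w) (p w)) &
          eqmod2 (tangent w) [:: varpi0 w; a1 w; a2 w] (extd a2 w)
            (structure_eq2 k (o1 w) (o2 w) (p w))]].

(* The rank 2 prolongation, as a set of pairs (point, plane). *)
Definition Sigma : set ('rV[R]_8 * {vspace 'rV[R]_8}) :=
  [set e | locus e.1 /\
     integral_element2 tangent [:: varpi0; varpi1; varpi2] e.1 e.2].

Definition trivial_prolongation : Prop := set_bij Sigma locus fst.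

Definition prolongation_circle_bundle : Prop :=
  smooth_bundle (@circle R) (grass_embed @` Sigma) locus fst.

End System.
End Jets.

(* Main.v *)
(* At a point w of the locus the fibre D(w) is spanned by X1, X2 (lifts of the
   total derivatives in x and y) and the vertical vector Y, the cross product
   of the symbols of F and G. The restrictions b1, b2 of d varpi1, d varpi2 to
   this 3-dimensional space are alternating forms, each with a kernel vector,
   and a plane of D(w) is integral iff it contains both kernel vectors. So
   there is a single integral plane when b1, b2 are independent, and a circle of
   planes, namely those through a line, when they are proportional. (They are
   never both zero, since Y is not.)

   To read the rank of (b1, b2) off the structure equations of an arbitrary
   coframe one needs that d a restricted to D is a combination of b1, b2 for
   every form a killing D along the locus. By d a(X, Y) = - a([X, Y]) for fields
   in D, this reduces to the tangency of [X, Y] to the locus (symmetry of second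
   derivatives) and to the fact that a function vanishing on the locus has zero
   derivative in tangent directions (a weak implicit function theorem).

   In type (I) let k be the smooth kernel vector field and (k, e, f) a smooth
   orthogonal frame of D. The plane through k and al e + be f is sent to the
   point ((al^2 - be^2) / (al^2 + be^2), 2 al be / (al^2 + be^2)) of the circle;
   both this map and its inverse are rational in the orthogonal projection. *)

(* The forms of a coframe kill D only along the locus, and the structure equations hold only at the
   base point. So functions such as a(X) can be differentiated only in tangent directions; the
   tangency fact behind this is obtained by minimising F^2 + G^2 near a point, not from a
   parametrisation of the locus.

   A type enters through one fact of linear algebra. In type (I), [a1] is independent of varpi0 and
   d [a1] vanishes on D, which is a non-trivial relation between b1 and b2. In the other types d
   [a1] and d [a2] are independent on D and lie in the span of b1 and b2.

   The direction al e + be f matters only up to a scalar, so the fibre is a projective line.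
   Doubling the angle identifies it with the circle: both coordinates are homogeneous of degree 0 in
   (al, be). The ratio of proportional forms may be zero or infinite, so the kernel field is taken
   from b1 or from b2 according to the point. *)
From HB Require Import structures.
Require Import Defs.
From mathcomp Require Import all_boot all_order all_algebra.
From mathcomp Require Import all_classical all_reals all_analysis.
From mathcomp Require Import ring lra.

Set Implicit Arguments.
Unset Strict Implicit.
Unset Printing Implicit Defensive.

Import Order.TTheory GRing.Theory Num.Theory.
Import numFieldNormedType.Exports.

Local Open Scope classical_set_scope.
Local Open Scope ring_scope.

(** * Smooth maps *)

Section SmoothCalculus.
Context {R : realType}.
Implicit Types V W : normedModType R.

(* [n]-th level of smoothness, unfolding [iter_derive] from the inside, so that
   product and quotient rules can be used by induction on [n]. *)
Fixpoint diffn (n : nat) V W (U : set V) (f : V -> W) : Prop :=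
  (forall x, U x -> differentiable f x) /\
  if n is n'.+1 then forall v, diffn n' U ('D_v f) else True.

Lemma diffn_diff n V W (U : set V) (f : V -> W) x :
  diffn n U f -> U x -> differentiable f x.
Proof. by case: n => [|n] [+ _] => /[apply]. Qed.

Lemma smooth_onP V W (U : set V) (f : V -> W) :
  smooth_on U f <-> forall n, diffn n U f.
Proof.
split=> [+ n|].
  elim: n f => [|n IHn] f sf /=; split => //; try exact: (sf [::]).
  by move=> v; apply: IHn => s x Ux; have := sf (rcons s v) x Ux;
     rewrite /iter_derive foldr_rcons.
(* The last vector of the list is the innermost derivative in [iter_derive], which is the one that
   [diffn] unfolds. *)
move=> + s; elim/last_ind: s f => [|s v IHs] f df x Ux.
  exact: diffn_diff (df 0%N) Ux.
rewrite /iter_derive foldr_rcons; apply: IHs => // n.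
by have [_] := df n.+1; apply.
Qed.

Lemma diffnS n V W (U : set V) (f : V -> W) : diffn n.+1 U f -> diffn n U f.
Proof.
elim: n f => [|n IHn] f; first by case.
by move=> [df Df]; split => // v; apply: IHn; apply: Df.
Qed.

(** Locality of differentiability reduces to this case by subtraction. The zero map satisfies the
    expansion at x, and [diff_unique] identifies it with the differential. *)
Lemma differentiable_near0 V W (h : V -> W) x :
  (\near x, h x = 0) -> differentiable h x.
Proof.
move=> h0; have hx : h x = 0 by exact: nbhs_singleton h0.
have E : h \o shift x = cst (h x) + (\0 : {linear V -> W}) +o_ 0 id.
  apply/eqaddoE/eqaddoP => _/posnumP[e].
  have := h0; rewrite (near_shift 0) subr0; apply: filterS => y /= h0y.
  by rewrite !fctE /= hx addr0 subr0 h0y normr0 mulr_ge0.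
apply/diff_locallyP; have c0 : continuous (\0 : {linear V -> W}) by exact: cst_continuous.
by have H := diff_unique c0 E; rewrite H; split; [exact: c0|exact: E].
Qed.

Lemma differentiable_near V W (f g : V -> W) x :
  (\near x, f x = g x) -> differentiable f x -> differentiable g x.
Proof.
move=> fg df; have -> : g = f + (g - f) by apply/funext => y; rewrite !fctE subrKC.
apply: differentiableD => //; apply: differentiable_near0.
by near=> y; rewrite !fctE (near fg y)// subrr.
Unshelve. all: by end_near. Qed.

Lemma diffn_eq n V W (U : set V) (f g : V -> W) : open U ->
  (forall x, U x -> f x = g x) -> diffn n U f -> diffn n U g.
Proof.
move=> oU; elim: n f g => [|n IHn] f g fg df;
  have fgx x : U x -> \near x, f x = g x
    by move=> Ux; apply: filterS (open_nbhs_nbhs (conj oU Ux)).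
  by split=> // x Ux; apply: differentiable_near (fgx _ Ux) (diffn_diff df Ux).
split=> [x Ux|v]; first exact: differentiable_near (fgx _ Ux) (diffn_diff df Ux).
have [_ Df] := df; apply: IHn (Df v) => x Ux.
exact: near_eq_derive (fgx _ Ux).
Qed.

Lemma derive_linl V W W' (L : {linear W -> W'}) (f : V -> W) v x : continuous L ->
  differentiable f x -> 'D_v (L \o f) x = L ('D_v f x).
Proof.
move=> cL df; have dL y : differentiable L y by exact: linear_differentiable.
rewrite (deriveE v (differentiable_comp df (dL _))) (deriveE v df).
by rewrite (diff_comp df (dL _)) /= (diff_lin _ cL).
Qed.

Lemma diffn_linl n V W W' (L : {linear W -> W'}) (U : set V) (f : V -> W) :
  open U -> continuous L -> diffn n U f -> diffn n U (L \o f).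
Proof.
move=> oU cL; elim: n f => [|n IHn] f df; split; [move=> x Ux|by []|move=> x Ux|move=> v].
1,2: apply: differentiable_comp; [exact: diffn_diff df Ux|exact: linear_differentiable].
have [_ Df] := df; apply: diffn_eq (IHn _ (Df v)) => // x Ux.
by rewrite /= derive_linl//; exact: diffn_diff df Ux.
Qed.

Lemma derive_linr V V' W (L : {linear V' -> V}) (f : V -> W) v x :
  'D_v (f \o L) x = 'D_(L v) f (L x).
Proof.
rewrite /derive; set g := (fun h : R => _); set g' := (fun h : R => _ : W).
suff -> : g = g' by [].
by apply/funext => h; rewrite /g /g' /= (linearD L) (linearZZ L).
Qed.

Lemma diffn_linr n V V' W (L : {linear V' -> V}) (U : set V) (f : V -> W) :
  continuous L -> diffn n U f -> diffn n (L @^-1` U) (f \o L).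
Proof.
move=> cL; elim: n f => [|n IHn] f df; split; [move=> x Ux|by []|move=> x Ux|move=> v].
1,2: apply: differentiable_comp; [exact: linear_differentiable|exact: diffn_diff df Ux].
have -> : 'D_v (f \o L) = 'D_(L v) f \o L.
  by apply/funext => x; rewrite derive_linr.
by have [_ Df] := df; exact: (IHn _ (Df (L v))).
Qed.

Lemma diffn_cst n V W (U : set V) (c : W) : diffn n U (cst c).
Proof.
elim: n c => [|n IHn] c; split; [by []|by []|by []|move=> v].
have -> : 'D_v (cst c) = cst 0 :> (V -> W) by apply/funext => x; rewrite derive_cst.
exact: IHn.
Qed.

Lemma diffn_lin n V W (U : set V) (L : {linear V -> W}) : continuous L ->
  diffn n U L.
Proof.
move=> cL; case: n => [|n]; split; [move=> x _|by []|move=> x _|move=> v];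
  try exact: linear_differentiable.
have -> : 'D_v L = cst (L v).
  by apply/funext => x; rewrite deriveE ?diff_lin//; exact: linear_differentiable.
exact: diffn_cst.
Qed.

Lemma diffnD n V W (U : set V) (f g : V -> W) : open U ->
  diffn n U f -> diffn n U g -> diffn n U (f \+ g).
Proof.
move=> oU; elim: n f g => [|n IHn] f g df dg; split; [move=> x Ux|by []|move=> x Ux|move=> v].
1,2: by apply: differentiableD; [exact: diffn_diff df Ux|exact: diffn_diff dg Ux].
have [_ Df] := df; have [_ Dg] := dg.
apply: diffn_eq (IHn _ _ (Df v) (Dg v)) => // x Ux.
by rewrite /= -deriveD//; apply: diff_derivable;
  [exact: diffn_diff df Ux|exact: diffn_diff dg Ux].
Qed.

Lemma diffnM n V (U : set V) (f g : V -> R) : open U ->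
  diffn n U f -> diffn n U g -> diffn n U (fun x => f x * g x).
Proof.
move=> oU; elim: n f g => [|n IHn] f g df dg; split; [move=> x Ux|by []|move=> x Ux|move=> v].
1,2: by apply: differentiableM; [exact: diffn_diff df Ux|exact: diffn_diff dg Ux].
have [_ Df] := df; have [_ Dg] := dg.
have := diffnD oU (IHn _ _ (diffnS df) (Dg v)) (IHn _ _ (diffnS dg) (Df v)).
apply: diffn_eq => // x Ux.
by rewrite /= deriveM//; apply: diff_derivable;
  [exact: diffn_diff df Ux|exact: diffn_diff dg Ux].
Qed.

(** The derivative of 1/f is -(1/f)^2 f', so the previous level of smoothness of 1/f itself gives
    the next one. *)
Lemma diffnV n V (U : set V) (f : V -> R) : open U -> (forall x, U x -> f x != 0) ->
  diffn n U f -> diffn n U (fun x => (f x)^-1).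
Proof.
move=> oU f0; elim: n f f0 => [|n IHn] f f0 df; split; [move=> x Ux|by []|move=> x Ux|move=> v].
1,2: by apply: differentiableV; [exact: diffn_diff df Ux|exact: f0].
have [_ Df] := df; have dV := IHn _ f0 (diffnS df).
have := diffnM oU (diffnM oU (diffn_cst n U (-1 : R)) (diffnM oU dV dV)) (Df v).
apply: diffn_eq => // x Ux.
rewrite deriveV; [|exact: f0|exact/diff_derivable/(diffn_diff df)].
by rewrite /= /GRing.scale/= mulN1r expr2 invfM.
Qed.

Lemma smooth_on_diff V W (U : set V) (f : V -> W) x :
  smooth_on U f -> U x -> differentiable f x.
Proof. by move=> sf Ux; exact: (sf [::]). Qed.

Lemma smooth_on_derive V W (U : set V) (f : V -> W) v :
  smooth_on U f -> smooth_on U ('D_v f).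
Proof. by move=> /smooth_onP sf; apply/smooth_onP => n; have [_] := sf n.+1; apply. Qed.

Lemma smooth_on_sub V W (U U' : set V) (f : V -> W) :
  U' `<=` U -> smooth_on U f -> smooth_on U' f.
Proof. by move=> sU sf s x /sU; exact: sf. Qed.

Lemma smooth_on_eq V W (U : set V) (f g : V -> W) : open U ->
  (forall x, U x -> f x = g x) -> smooth_on U f -> smooth_on U g.
Proof. by move=> oU fg /smooth_onP sf; apply/smooth_onP => n; exact: diffn_eq (sf n). Qed.

Lemma smooth_on_linl V W W' (L : {linear W -> W'}) (U : set V) (f : V -> W) :
  open U -> continuous L -> smooth_on U f -> smooth_on U (L \o f).
Proof. by move=> oU cL /smooth_onP sf; apply/smooth_onP => n; exact: diffn_linl. Qed.

Lemma smooth_on_linr V V' W (L : {linear V' -> V}) (U : set V) (f : V -> W) :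
  continuous L -> smooth_on U f -> smooth_on (L @^-1` U) (f \o L).
Proof. by move=> cL /smooth_onP sf; apply/smooth_onP => n; exact: diffn_linr. Qed.

Lemma smooth_on_cst V W (U : set V) (c : W) : smooth_on U (cst c).
Proof. by apply/smooth_onP => n; exact: diffn_cst. Qed.

Lemma smooth_on_lin V W (U : set V) (L : {linear V -> W}) : continuous L ->
  smooth_on U L.
Proof. by move=> cL; apply/smooth_onP => n; exact: diffn_lin. Qed.

Lemma smooth_onD V W (U : set V) (f g : V -> W) : open U ->
  smooth_on U f -> smooth_on U g -> smooth_on U (fun x => f x + g x).
Proof.
by move=> oU /smooth_onP sf /smooth_onP sg; apply/smooth_onP => n; exact: diffnD.
Qed.

Lemma smooth_onM V (U : set V) (f g : V -> R) : open U ->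
  smooth_on U f -> smooth_on U g -> smooth_on U (fun x => f x * g x).
Proof.
by move=> oU /smooth_onP sf /smooth_onP sg; apply/smooth_onP => n; exact: diffnM.
Qed.

Lemma smooth_onV V (U : set V) (f : V -> R) : open U -> (forall x, U x -> f x != 0) ->
  smooth_on U f -> smooth_on U (fun x => (f x)^-1).
Proof. by move=> oU f0 /smooth_onP sf; apply/smooth_onP => n; exact: diffnV. Qed.

Lemma smooth_onN V (U : set V) (f : V -> R) : open U ->
  smooth_on U f -> smooth_on U (fun x => - f x).
Proof.
move=> oU sf; have := smooth_onM oU (smooth_on_cst (-1 : R)) sf.
by apply: smooth_on_eq => // x _; rewrite mulN1r.
Qed.

Lemma smooth_on_sum V W (U : set V) (I : Type) (r : seq I) (f : I -> V -> W) :
  open U -> (forall i, smooth_on U (f i)) ->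
  smooth_on U (fun x => \sum_(i <- r) f i x).
Proof.
move=> oU sf; elim: r => [|i r IHr].
  by apply: smooth_on_eq (smooth_on_cst 0) => // x _; rewrite big_nil.
by apply: smooth_on_eq (smooth_onD oU (sf i) IHr) => // x _; rewrite big_cons.
Qed.

Lemma smooth_onZl V W (U : set V) (f : V -> R) (c : W) : open U ->
  smooth_on U f -> smooth_on U (fun x => f x *: c).
Proof.
move=> oU sf.
(* A linear structure is packed locally so that composition with a continuous linear map applies;
   coordinates, pairs and projections are treated in the same way. *)
have sx_lin : linear ( *:%R ^~ c : R -> _).
  by move=> u y z; rewrite scalerDl scalerA.
pose sxlM := GRing.isLinear.Build _ _ _ _ _ sx_lin.
pose sxL : {linear _ -> _} := HB.pack ( *:%R ^~ c) sxlM.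
by apply: (@smooth_on_linl _ _ _ sxL) => //; exact: scalel_continuous.
Qed.

Lemma smooth_on_coord V m n (U : set V) (f : V -> 'M[R]_(m, n)) i j : open U ->
  smooth_on U f -> smooth_on U (fun x => f x i j).
Proof.
move=> oU sf.
have lin : linear (fun M : 'M[R]_(m, n) => M i j : R).
  by move=> a u v; rewrite !mxE.
pose lM := GRing.isLinear.Build _ _ _ _ _ lin.
pose L : {linear _ -> _} := HB.pack (fun M : 'M[R]_(m, n) => M i j : R) lM.
by apply: (@smooth_on_linl _ _ _ L) => //; exact: coord_continuous.
Qed.

Lemma smooth_on_mx V m n (U : set V) (f : V -> 'M[R]_(m, n)) : open U ->
  (forall i j, smooth_on U (fun x => f x i j)) -> smooth_on U f.
Proof.
move=> oU sf; apply: smooth_on_eq (_ : smooth_on U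
   (fun x => \sum_(i < m) \sum_(j < n) f x i j *: delta_mx i j)) => //.
  by move=> x _; rewrite -matrix_sum_delta.
by do 2![apply: smooth_on_sum => // ?]; exact: smooth_onZl.
Qed.

Lemma smooth_on_pair V W W' (U : set V) (f : V -> W) (g : V -> W') : open U ->
  smooth_on U f -> smooth_on U g -> smooth_on U (fun x => (f x, g x)).
Proof.
move=> oU sf sg.
have lin1 : linear (fun w : W => (w, 0) : W * W').
  by move=> a u v; congr pair; rewrite /= scaler0 addr0.
have lin2 : linear (fun w : W' => (0, w) : W * W').
  by move=> a u v; congr pair; rewrite /= scaler0 addr0.
pose M1 := GRing.isLinear.Build _ _ _ _ _ lin1.
pose L1 : {linear _ -> _} := HB.pack (fun w : W => (w, 0) : W * W') M1.
pose M2 := GRing.isLinear.Build _ _ _ _ _ lin2.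
pose L2 : {linear _ -> _} := HB.pack (fun w : W' => (0, w) : W * W') M2.
have := smooth_onD oU (@smooth_on_linl _ _ _ L1 _ _ oU _ sf)
  (@smooth_on_linl _ _ _ L2 _ _ oU _ sg).
move=> H; apply: smooth_on_eq (H _ _) => // [x _|x|x].
- by congr pair; rewrite /= ?addr0 ?add0r.
- by apply: cvg_pair => //=; exact: cvg_cst.
- by apply: cvg_pair => //=; exact: cvg_cst.
Qed.

Lemma smooth_on_fst V V' W (U : set V) (f : V -> W) :
  smooth_on U f -> smooth_on (fst @^-1` U) (fun z : V * V' => f z.1).
Proof.
move=> sf.
have lin : linear (fst : V * V' -> V) by move=> a u v.
pose M := GRing.isLinear.Build _ _ _ _ _ lin.
pose L : {linear _ -> _} := HB.pack (fst : V * V' -> V) M.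
by apply: (@smooth_on_linr _ _ _ L) => // x; exact: cvg_fst.
Qed.

Lemma smooth_on_snd V V' W (U : set V') (f : V' -> W) :
  smooth_on U f -> smooth_on (snd @^-1` U) (fun z : V * V' => f z.2).
Proof.
move=> sf.
have lin : linear (snd : V * V' -> V') by move=> a u v.
pose M := GRing.isLinear.Build _ _ _ _ _ lin.
pose L : {linear _ -> _} := HB.pack (snd : V * V' -> V') M.
by apply: (@smooth_on_linr _ _ _ L) => // x; exact: cvg_snd.
Qed.

Lemma smooth_on_id V (U : set V) : smooth_on U id.
Proof. by apply: (@smooth_on_lin _ _ _ idfun) => x. Qed.

End SmoothCalculus.

(** * First and second order expansions *)

Section FirstOrder.
Context {R : realType} {V W : normedModType R}.
Implicit Types (f : V -> W) (x u v : V).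

Lemma deriveDv f x u v :
  differentiable f x -> 'D_(u + v) f x = 'D_u f x + 'D_v f x.
Proof. by move=> df; rewrite !deriveE// linearD. Qed.

Lemma deriveZv f x (a : R) u :
  differentiable f x -> 'D_(a *: u) f x = a *: 'D_u f x.
Proof. by move=> df; rewrite !deriveE// linearZ. Qed.

Lemma is_derive_line f x u (t : R) : differentiable f (x + t *: u) ->
  is_derive t 1 (fun t : R => f (x + t *: u)) ('D_u f (x + t *: u)).
Proof.
move=> df.
pose l : R -> V := cst x + (fun s : R => s *: u).
have dl : is_diff t l (0 + (fun s : R => s *: u)) by exact: is_diffD.
have dfl : differentiable f (l t) by [].
have -> : (fun t : R => f (x + t *: u)) = f \o l by [].
have dc : differentiable (f \o l) t by apply: differentiable_comp => //; exact: ex_diff.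
apply: DeriveDef; first exact: diff_derivable.
have dll : differentiable l t by exact: ex_diff.
rewrite (deriveE (1 : R) dc) (diff_comp dll dfl) (deriveE u df) /= diff_val.
by rewrite fctE /= add0r scale1r.
Qed.

Lemma first_order f x : differentiable f x -> forall e : R, 0 < e ->
  exists2 r : R, 0 < r & forall k, `|k| < r ->
    `|f (x + k) - f x - 'D_k f x| <= e * `|k|.
Proof.
move=> df e e0; have /diff_locallyP [_ /eqaddoP] := df.
move=> /(_ _ e0) /nbhs_ballP[r /= r0 H]; exists r => // k kr.
have := H k; rewrite -ball_normE /= sub0r normrN => /(_ kr).
by rewrite !fctE /= deriveE// opprD addrA (addrC k).
Qed.

End FirstOrder.

Section SecondDerivatives.
Context {R : realType} {V : normedModType R}.
Implicit Types (f g : V -> R) (x u v w : V).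

Lemma mean_value f x u (h : R) : 0 <= h -> (forall y, differentiable f y) ->
  exists2 t : R, 0 <= t <= h & f (x + h *: u) - f x = h * 'D_u f (x + t *: u).
Proof.
move=> h0 df.
have dl t := is_derive_line (df (x + t *: u)).
have [//|t th Ht] := MVT_segment h0 (fun t _ => dl t).
  apply: derivable_within_continuous => t _; exact: (@ex_derive _ _ _ _ _ _ _ (dl t)).
exists t; first by move: th; rewrite in_itv.
by move: Ht; rewrite scale0r addr0 subr0 mulrC.
Qed.

Lemma derive_shiftr f x u c : 'D_u (fun y => f (y + c)) x = 'D_u f (x + c).
Proof.
rewrite /derive; set g := (fun h : R => _); set g' := (fun h : R => _ : R).
suff -> : g = g' by [].
by apply/funext => h; rewrite /g /g' /= addrA.
Qed.

(* The left-hand side is symmetric in [u] and [v]. *)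
Lemma second_difference f x u v (h : R) : 0 < h -> smooth_on setT f ->
  exists s t : R, [/\ 0 <= s <= h, 0 <= t <= h &
  f (x + h *: u + h *: v) - f (x + h *: u) - (f (x + h *: v) - f x) =
   h ^+ 2 * 'D_v ('D_u f) (x + s *: u + t *: v)].
Proof.
move=> h0 sf; have df y : differentiable f y by exact: smooth_on_diff sf _.
have dDf y : differentiable ('D_u f) y.
  exact: smooth_on_diff (smooth_on_derive u sf) _.
have df' y : differentiable (fun y => f (y + h *: v)) y.
  have ds : differentiable (id + cst (h *: v)) y.
    by apply: differentiableD; [exact: ex_diff|exact: differentiable_cst].
  exact: differentiable_comp ds (df _).
(* The mean value theorem is applied twice: to y |-> f (y + h v) - f y in the direction u, then to
   ['D_u f] in the direction v. *)
have [s sh Hs] := @mean_value ((fun y => f (y + h *: v)) - f) x u h (ltW h0)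
  (fun y => differentiableB (df' y) (df y)).
have [t th Ht] := @mean_value ('D_u f) (x + s *: u) v h (ltW h0) dDf.
exists s, t; split=> //; rewrite expr2 -mulrA -Ht; move: Hs; rewrite !fctE => ->.
rewrite deriveB; [|exact: diff_derivable..].
by rewrite derive_shiftr.
Qed.

Lemma continuous_box f x u v (e : R) : 0 < e -> {for x, continuous f} ->
  exists2 d : R, 0 < d & forall s t, 0 <= s <= d -> 0 <= t <= d ->
    `|f (x + s *: u + t *: v) - f x| <= e.
Proof.
move=> e0 /cvgrPdist_lt /(_ _ e0) /nbhs_ballP[r /= r0 H].
have M0 : 0 < `|u| + `|v| + 1 by rewrite ltr_wpDl// addr_ge0.
(* The summand 1 keeps the denominator positive when u = v = 0, and the half makes the final bound
   strict. *)
exists (r / 2 / (`|u| + `|v| + 1)); first by rewrite !divr_gt0.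
move=> s t /andP[s0 sd] /andP[t0 td]; rewrite distrC ltW//; apply: H.
rewrite -ball_normE /= -addrA opprD addNKr normrN.
apply: (@le_lt_trans _ _ (r / 2)); last by rewrite ltr_pdivrMr// ltr_pMr// ltr1n.
apply: le_trans (ler_normD _ _) _; rewrite !normrZ !ger0_norm//.
apply: (@le_trans _ _ (r / 2 / (`|u| + `|v| + 1) * (`|u| + `|v|))).
  by rewrite mulrDr lerD// ler_wpM2r.
rewrite -[leRHS](divfK (lt0r_neq0 M0)) ler_wpM2l//; last by rewrite lerDl.
by rewrite ltW// !divr_gt0.
Qed.

(** Both points tend to x with h, so for small h the common value is within e / 2 of P x and of Q
    x. *)
Lemma continuous_coincide (P Q : V -> R) x u v :
  {for x, continuous P} -> {for x, continuous Q} ->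
  (forall h, 0 < h -> exists s t s' t', [/\ 0 <= s <= h, 0 <= t <= h,
     0 <= s' <= h, 0 <= t' <= h &
     P (x + s *: u + t *: v) = Q (x + s' *: v + t' *: u)]) -> P x = Q x.
Proof.
move=> cP cQ H.
apply/eqP; rewrite -subr_eq0 -normr_eq0 eq_le normr_ge0 andbT.
apply/ler_addgt0Pl => e e0; rewrite addr0.
have e2 : 0 < e / 2 by rewrite divr_gt0.
have [d d0 Hd] := continuous_box u v e2 cP.
have [d' d'0 Hd'] := continuous_box v u e2 cQ.
have h0 : 0 < Num.min d d' by rewrite lt_min d0.
have [s [t [s' [t' [/andP[s0 sh] /andP[t0 th] /andP[s'0 s'h] /andP[t'0 t'h] E]]]]] :=
  H _ h0.
have hd : Num.min d d' <= d by rewrite ge_min lexx.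
have hd' : Num.min d d' <= d' by rewrite ge_min lexx orbT.
have A : `|P (x + s *: u + t *: v) - P x| <= e / 2.
  by apply: Hd; rewrite ?s0 ?t0 /=; [exact: le_trans sh hd|exact: le_trans th hd].
have B : `|Q (x + s' *: v + t' *: u) - Q x| <= e / 2.
  by apply: Hd'; rewrite ?s'0 ?t'0 /=; [exact: le_trans s'h hd'|exact: le_trans t'h hd'].
rewrite [leRHS]splitr; rewrite distrC in A; rewrite -E in B.
by apply: le_trans (lerD A B); apply: le_trans (ler_normD _ _); rewrite addrA subrK.
Qed.

(** The second difference is h^2 times either mixed derivative, each at some point of a box of size
    h; division by h^2 leaves the situation of [continuous_coincide]. *)
Lemma derive_comm f x u v : smooth_on setT f ->
  'D_u ('D_v f) x = 'D_v ('D_u f) x.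
Proof.
move=> sf.
have cc a b : {for x, continuous ('D_a ('D_b f))}.
  apply: differentiable_continuous.
  exact: smooth_on_diff (smooth_on_derive _ (smooth_on_derive _ sf)) _.
apply: (@continuous_coincide _ _ x v u (cc u v) (cc v u)) => h h0.
have [s [t [hs ht E]]] := @second_difference f x u v h h0 sf.
have [s' [t' [hs' ht' E']]] := @second_difference f x v u h h0 sf.
exists s', t', s, t; split; [exact: hs'|exact: ht'|exact: hs|exact: ht|].
move: E E'; move: ('D_v ('D_u f) _) ('D_u ('D_v f) _) => p q E E'.
have h20 : h ^+ 2 != 0 by rewrite expf_neq0// gt_eqF.
apply: (mulfI h20); rewrite -E -E' [x + h *: v + h *: u]addrAC; ring.
Qed.

End SecondDerivatives.

(** * Functions vanishing on a level set *)

Section Tangency.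
Context {R : realType} {V : normedModType R}.
Implicit Types (f g F G : V -> R) (x u v w A B : V).

Lemma derive_pos_min (phi : R -> R) (d l : R) : 0 < d -> is_derive (0 : R) (1 : R) phi l ->
  (forall t, derivable phi t (1 : R)) ->
  (forall t, `|t| < d -> phi 0 <= phi t) -> l = 0.
Proof.
move=> d0 dl dphi H.
have dd : - d <= d by rewrite ge0_cp // ltW.
have H0 : is_derive (0 : R) (1 : R) phi 0.
  apply: (@derive1_at_min _ _ (- d) d) => //.
    by rewrite in_itv /= oppr_lt0 d0.
  by move=> t; rewrite in_itv /= -ltr_norml; exact: H.
by rewrite -(@derive_val _ _ _ _ _ _ _ dl) (@derive_val _ _ _ _ _ _ _ H0).
Qed.

Lemma box_min (phi : 'rV[R]_2 -> R) (c : R) : 0 <= c -> continuous phi ->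
  exists2 y : 'rV[R]_2, (forall j, `|y 0 j| <= c) &
    forall z : 'rV[R]_2, (forall j, `|z 0 j| <= c) -> phi y <= phi z.
Proof.
move=> c0 cphi; pose A : set 'rV[R]_2 := [set v | forall i, `[- c, c]%classic (v ord0 i)].
have cA : compact A by apply: (@rV_compact _ _ (fun=> `[- c, c]%classic)) => i; exact: segment_compact.
have AP z : A z <-> forall j, `|z 0 j| <= c.
  by split=> H j; have := H j; rewrite /= in_itv /= ler_norml.
have A0 : A !=set0 by exists 0; apply/AP => j; rewrite mxE normr0.
have [|y yA ymin] := EVT_min_rV A0 cA (f := phi).
  exact: continuous_subspaceT.
exists y; first by apply/AP; rewrite inE in yA.
by move=> z /AP zA; apply: ymin; rewrite inE.
Qed.

Lemma sqr_sum_le (p q s : R) :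
  `|p| <= s / 4 -> `|q| <= s / 4 -> p ^+ 2 + q ^+ 2 <= s ^+ 2 / 8.
Proof.
rewrite !ler_norml => /andP[p1 p2] /andP[q1 q2].
have : 0 <= (s / 4 - p) * (s / 4 + p) by rewrite mulr_ge0//; lra.
have : 0 <= (s / 4 - q) * (s / 4 + q) by rewrite mulr_ge0//; lra.
by move=> *; lra.
Qed.

(** If |a| = s, then |p| is at least 3 s / 4 and p^2 at least 9 s^2 / 16, above the bound s^2 / 8
    that [sqr_sum_le] gives at the centre of the box. This excludes a minimum on the boundary. *)
Lemma sqr_far (a p q s : R) : 0 < s -> p ^+ 2 + q <= s ^+ 2 / 8 -> 0 <= q ->
  `|p - a| <= s / 4 -> `|a| != s.
Proof.
move=> s0 pq q0; rewrite ler_norml => /andP[p1 p2]; apply/eqP => aE.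
have : s = a \/ s = - a.
  by rewrite -aE; case: (lerP 0 a) => [/ger0_norm|/ltr0_norm] ->; [left|right].
case=> E; have : 0 < s ^+ 2 by rewrite exprn_gt0.
  have : 0 <= (p - 3 / 4 * s) * (p + 3 / 4 * s) by rewrite mulr_ge0//; lra.
  lra.
have : 0 <= (- p - 3 / 4 * s) * (- p + 3 / 4 * s) by rewrite mulr_ge0//; lra.
lra.
Qed.

(** The matrix is within 1/4 of the identity in each entry, so its determinant exceeds 9/16 - 1/16
    and Cramer's rule leaves only the zero solution. The factors 2 come from differentiating
    squares. *)
Lemma near_identity_ker (fa ga fb gb p q : R) :
  `|fa - 1| < 1 / 4 -> `|fb - 0| < 1 / 4 -> `|ga - 0| < 1 / 4 -> `|gb - 1| < 1 / 4 ->
  2 * p * fa + 2 * q * ga = 0 -> 2 * p * fb + 2 * q * gb = 0 -> p = 0 /\ q = 0.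
Proof.
rewrite !ltr_norml => /andP[a1 a2] /andP[b1 b2] /andP[c1 c2] /andP[d1 d2] EA EB.
have D0 : fa * gb - fb * ga != 0.
  have : 0 < (fa - 3 / 4) * (gb - 3 / 4) by rewrite mulr_gt0//; lra.
  have : 0 < (1 / 4 - fb) * (1 / 4 + ga) by rewrite mulr_gt0//; lra.
  have : 0 < (1 / 4 + fb) * (1 / 4 - ga) by rewrite mulr_gt0//; lra.
  by move=> *; rewrite gt_eqF//; lra.
split; apply: (mulIf D0); rewrite mul0r.
  have -> : p * (fa * gb - fb * ga) =
    ((2 * p * fa + 2 * q * ga) * gb - (2 * p * fb + 2 * q * gb) * ga) / 2 by field.
  by rewrite EA EB; ring.
have -> : q * (fa * gb - fb * ga) =
    ((2 * p * fb + 2 * q * gb) * fa - (2 * p * fa + 2 * q * ga) * fb) / 2 by field.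
by rewrite EA EB; ring.
Qed.

(* The zero is found as the minimum of F^2 + G^2 over the box: the first-order
   expansions of F and G keep the minimum off the boundary, and at an interior
   critical point F = G = 0 since the partial derivatives along A and B are
   nearly those of a linear isomorphism. *)
Lemma zero_near_tangent F G w A B u (e : R) :
  (forall x, differentiable F x) -> (forall x, differentiable G x) ->
  (forall v, {for w, continuous ('D_v F)}) ->
  (forall v, {for w, continuous ('D_v G)}) ->
  F w = 0 -> G w = 0 ->
  'D_A F w = 1 -> 'D_B F w = 0 -> 'D_A G w = 0 -> 'D_B G w = 1 ->
  'D_u F w = 0 -> 'D_u G w = 0 -> 0 < e ->
  exists2 h0 : R, 0 < h0 & forall h, 0 < h < h0 -> exists a b : R,
    [/\ `|a| <= e * h, `|b| <= e * h &
        let k := h *: u + a *: A + b *: B in F (w + k) = 0 /\ G (w + k) = 0].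
Proof.
move=> dF dG cF cG Fw Gw FA FB GA GB Fu Gu e0.
(* On the box |a|, |b| <= e h the displacement has norm at most h C, so an error rate [eta] = e / (4
   C) costs at most e h / 4, the tolerance required by [sqr_far]. *)
pose C := `|u| + e * (`|A| + `|B|) + 1.
have C0 : 0 < C by rewrite ltr_wpDl// addr_ge0// mulr_ge0// ?addr_ge0// ltW.
pose eta := e / 4 / C; have eta0 : 0 < eta by rewrite !divr_gt0.
have [rF rF0 HF] := first_order (dF w) eta0.
have [rG rG0 HG] := first_order (dG w) eta0.
(* The threshold 1/4 is the one of [near_identity_ker]. *)
have near1 f v : {for w, continuous ('D_v f)} ->
    exists2 r, 0 < r & forall k, `|k| < r -> `|'D_v f (w + k) - 'D_v f w| < 1 / 4 :> R.
  have q : 0 < 1 / 4 :> R by rewrite divr_gt0.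
  move=> /cvgrPdist_lt /(_ _ q) /nbhs_ballP[r /= r0 H]; exists r => // k kr.
  rewrite distrC; apply: H; rewrite -ball_normE /= opprD addNKr normrN.
  exact: kr.
have [r1 r10 H1] := near1 _ _ (cF A); have [r2 r20 H2] := near1 _ _ (cF B).
have [r3 r30 H3] := near1 _ _ (cG A); have [r4 r40 H4] := near1 _ _ (cG B).
pose r := Num.min (Num.min rF rG) (Num.min (Num.min r1 r2) (Num.min r3 r4)).
have r0 : 0 < r by rewrite !lt_min rF0 rG0 r10 r20 r30 r40.
exists (r / C); first by rewrite divr_gt0.
move=> h /andP[h0 hr].
pose K a b := h *: u + a *: A + b *: B.
have Kn a b : `|a| <= e * h -> `|b| <= e * h -> `|K a b| <= h * C.
  move=> ha hb; apply: (@le_trans _ _ (h * `|u| + e * h * `|A| + e * h * `|B|)).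
    apply: le_trans (ler_normD _ _) _; rewrite normrZ lerD//; last by rewrite ler_wpM2r.
    apply: le_trans (ler_normD _ _) _; rewrite !normrZ lerD//; last by rewrite ler_wpM2r.
    by rewrite ger0_norm// ltW.
  rewrite /C -subr_ge0 (_ : _ - _ = h) ?(ltW h0)//.
  by move: `|u| `|A| `|B| => p q s; ring.
have Kr a b : `|a| <= e * h -> `|b| <= e * h -> `|K a b| < r.
  by move=> ha hb; apply: le_lt_trans (Kn _ _ ha hb) _; rewrite -ltr_pdivlMr.
(* By the normalisation of A and B, the linear parts of F and G along the displacement are exactly
   the box coordinates a and b. *)
have KF a b : 'D_(K a b) F w = a.
  by rewrite !deriveDv// !deriveZv// Fu FA FB !scaler0 add0r addr0 /GRing.scale/= mulr1.
have KG a b : 'D_(K a b) G w = b.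
  by rewrite !deriveDv// !deriveZv// Gu GA GB !scaler0 !add0r /GRing.scale/= mulr1.
have etaC a b : `|a| <= e * h -> `|b| <= e * h -> eta * `|K a b| <= e * h / 4.
  move=> ha hb; apply: le_trans (ler_wpM2l (ltW eta0) (Kn _ _ ha hb)) _.
  rewrite /eta; have -> : e / 4 / C * (h * C) = e * h / 4 by field; rewrite gt_eqF.
  by [].
have EF a b : `|a| <= e * h -> `|b| <= e * h -> `|F (w + K a b) - a| <= e * h / 4.
  move=> ha hb; apply: le_trans (etaC _ _ ha hb).
  have := HF (K a b); rewrite KF Fw subr0; apply.
  by apply: lt_le_trans (Kr _ _ ha hb) _; rewrite /r !ge_min lexx.
have EG a b : `|a| <= e * h -> `|b| <= e * h -> `|G (w + K a b) - b| <= e * h / 4.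
  move=> ha hb; apply: le_trans (etaC _ _ ha hb).
  have := HG (K a b); rewrite KG Gw subr0; apply.
  by apply: lt_le_trans (Kr _ _ ha hb) _; rewrite /r !ge_min lexx ?orbT.
have eh : 0 < e * h by rewrite mulr_gt0.
pose phi a b := F (w + K a b) ^+ 2 + G (w + K a b) ^+ 2.
have cphi : continuous (fun y : 'rV[R]_2 => phi (y 0 0) (y 0 1)).
  have cK : continuous (fun y : 'rV[R]_2 => w + K (y 0 0) (y 0 1)).
    have cs (v : V) i : continuous (fun y : 'rV[R]_2 => y 0 i *: v).
      move=> y; have c := @coord_continuous R 1 2 0 i y.
      exact: (@continuousZr_tmp _ V _ (fun y : 'rV[R]_2 => y 0 i : R) v y c).
    move=> y; have cu : {for y, continuous (cst (h *: u) : 'rV[R]_2 -> V)}.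
      exact: cst_continuous.
    have cw : {for y, continuous (cst w : 'rV[R]_2 -> V)} by exact: cst_continuous.
    exact: (continuousD cw (continuousD (continuousD cu (cs A 0 y)) (cs B 1 y))).
  have cc f (df : forall x, differentiable f x) :
      continuous (fun y : 'rV[R]_2 => f (w + K (y 0 0) (y 0 1)) ^+ 2).
    move=> y; have cf : {for y, continuous (fun y : 'rV[R]_2 => f (w + K (y 0 0) (y 0 1)))}.
      exact: continuous_comp (cK y) (differentiable_continuous (df _)).
    exact: (continuousM cf cf).
  by move=> y; exact: (continuousD (cc F dF y) (cc G dG y)).
have [y yb ymin] := box_min (ltW eh) cphi.
pose a := y 0 0; pose b := y 0 1.
have ha : `|a| <= e * h by exact: yb.
have hb : `|b| <= e * h by exact: yb.
have phimin a' b' : `|a'| <= e * h -> `|b'| <= e * h -> phi a b <= phi a' b'.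
  move=> ha' hb'; pose z : 'rV[R]_2 := \row_j (if j == 0 then a' else b').
  have := ymin z; rewrite /z !mxE /=; apply=> j; rewrite mxE.
  by case: ifP.
(* Comparison with the centre of the box, where |F| and |G| are at most e h / 4. *)
have phi0 : phi a b <= (e * h) ^+ 2 / 8.
  have n0 : `|0 : R| <= e * h by rewrite normr0 ltW.
  apply: le_trans (phimin 0 0 n0 n0) _.
  have := EF 0 0 n0 n0; have := EG 0 0 n0 n0; rewrite /phi !subr0.
  by move=> HG0 HF0; exact: sqr_sum_le.
have ai : `|a| < e * h.
  rewrite lt_neqAle ha andbT.
  by apply: (sqr_far eh phi0) => //; [exact: sqr_ge0|exact: EF].
have bi : `|b| < e * h.
  rewrite lt_neqAle hb andbT; rewrite /phi addrC in phi0.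
  by apply: (sqr_far eh phi0) => //; [exact: sqr_ge0|exact: EG].
exists a, b; split => //; rewrite -/(K a b).
pose x := w + K a b.
have dline v t : is_derive t (1 : R) (fun t : R => F (x + t *: v) ^+ 2 + G (x + t *: v) ^+ 2)
   (2 * F (x + t *: v) * 'D_v F (x + t *: v) + 2 * G (x + t *: v) * 'D_v G (x + t *: v)).
  have iF := is_derive_line (dF (x + t *: v)).
  have iG := is_derive_line (dG (x + t *: v)).
  refine (is_derive_eq (is_deriveD (is_deriveX 2 iF) (is_deriveX 2 iG)) _).
  by rewrite /GRing.scale /= !expr1.
have critA : 2 * F x * 'D_A F x + 2 * G x * 'D_A G x = 0.
  have := dline A 0; rewrite scale0r addr0 => H.
  have d0 : 0 < e * h - `|a| by rewrite subr_gt0.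
  apply: (derive_pos_min d0 H).
    by move=> t; exact: (@ex_derive _ _ _ _ _ _ _ (dline A t)).
  move=> t tb; rewrite scale0r addr0.
  have -> : x + t *: A = w + K (a + t) b.
    by rewrite /x /K scalerDl -addrA; congr (w + _); rewrite addrAC !addrA.
  apply: phimin => //; apply: le_trans (ler_normD _ _) _.
  by rewrite -lerBrDl ltW.
have critB : 2 * F x * 'D_B F x + 2 * G x * 'D_B G x = 0.
  have := dline B 0; rewrite scale0r addr0 => H.
  have d0 : 0 < e * h - `|b| by rewrite subr_gt0.
  apply: (derive_pos_min d0 H).
    by move=> t; exact: (@ex_derive _ _ _ _ _ _ _ (dline B t)).
  move=> t tb; rewrite scale0r addr0.
  have -> : x + t *: B = w + K a (b + t).
    by rewrite /x /K scalerDl !addrA.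
  apply: phimin => //; apply: le_trans (ler_normD _ _) _.
  by rewrite -lerBrDl ltW.
have xr s : r <= s -> `|K a b| < s by apply: lt_le_trans; exact: Kr.
have := H1 (K a b) (xr _ _); have := H2 (K a b) (xr _ _).
have := H3 (K a b) (xr _ _); have := H4 (K a b) (xr _ _).
rewrite FA FB GA GB -/x /r !ge_min !lexx ?orbT.
move=> /(_ isT) P4 /(_ isT) P3 /(_ isT) P2 /(_ isT) P1.
exact: near_identity_ker P1 P2 P3 P4 critA critB.
Qed.

(** By [zero_near_tangent] the locus contains points w + k with k = h u up to an arbitrarily small
    multiple of h. There g vanishes, while its first-order expansion is h ['D_u g w] up to a small
    multiple of h. *)
Lemma derive_tangent0 F G g w A B u :
  (forall x, differentiable F x) -> (forall x, differentiable G x) ->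
  (forall v, {for w, continuous ('D_v F)}) ->
  (forall v, {for w, continuous ('D_v G)}) ->
  F w = 0 -> G w = 0 ->
  'D_A F w = 1 -> 'D_B F w = 0 -> 'D_A G w = 0 -> 'D_B G w = 1 ->
  'D_u F w = 0 -> 'D_u G w = 0 ->
  differentiable g w -> (\near w, F w = 0 -> G w = 0 -> g w = 0) ->
  'D_u g w = 0.
Proof.
move=> dF dG cF cG Fw Gw FA FB GA GB Fu Gu dg g0.
have gw : g w = 0 by exact: (nbhs_singleton g0).
apply/eqP; rewrite -normr_eq0 eq_le normr_ge0 andbT.
apply/ler_addgt0Pl => e e0; rewrite addr0.
(* The allowance e is split in two: [d] bounds the contribution of the corrections along A and B by
   e h / 2, and [eta] does so for the remainder of g. *)
pose M := `|'D_A g w| + `|'D_B g w| + 1.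
have M0 : 0 < M by rewrite ltr_wpDl// addr_ge0.
pose d := e / 2 / M; have d0 : 0 < d by rewrite !divr_gt0.
pose C := `|u| + d * (`|A| + `|B|) + 1.
have C0 : 0 < C by rewrite ltr_wpDl// addr_ge0// mulr_ge0// ?addr_ge0// ltW.
pose eta := e / 2 / C; have eta0 : 0 < eta by rewrite !divr_gt0.
have [r r0 Hg] := first_order dg eta0.
have /nbhs_ballP[s /= s0 Hs] := g0.
have [h0 h00 H] := zero_near_tangent dF dG cF cG Fw Gw FA FB GA GB Fu Gu d0.
have m0 : 0 < Num.min h0 (Num.min r s / C).
  by rewrite lt_min h00 divr_gt0// lt_min r0.
have [h hp hm] : exists2 h, 0 < h & h < Num.min h0 (Num.min r s / C).
  exists (Num.min h0 (Num.min r s / C) / 2); first by rewrite divr_gt0.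
  by rewrite ltr_pdivrMr// ltr_pMr// ltr1n.
have [|a [b [ha hb]]] := H h; first by rewrite hp (lt_le_trans hm)// ge_min lexx.
set k := _ + _ => /= -[Fk Gk].
have kn : `|k| <= h * C.
  apply: (@le_trans _ _ (h * `|u| + d * h * `|A| + d * h * `|B|)).
    apply: le_trans (ler_normD _ _) _; rewrite normrZ lerD//; last by rewrite ler_wpM2r.
    apply: le_trans (ler_normD _ _) _; rewrite !normrZ lerD//; last by rewrite ler_wpM2r.
    by rewrite (gtr0_norm hp).
  rewrite /C -subr_ge0 (_ : _ - _ = h) ?(ltW hp)//.
  by move: `|u| `|A| `|B| => p q t; ring.
have kl : `|k| < Num.min r s.
  apply: le_lt_trans kn _; rewrite -ltr_pdivlMr//; apply: lt_le_trans hm _.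
  by rewrite ge_min lexx orbT.
have gk : g (w + k) = 0.
  apply: (Hs (w + k)) Fk Gk; rewrite -ball_normE /= opprD addNKr normrN.
  by apply: lt_le_trans kl _; rewrite ge_min lexx orbT.
have {Hg} := Hg k; rewrite gk gw subr0 sub0r normrN => Hg.
have {}Hg : `|'D_k g w| <= e / 2 * h.
  have -> : e / 2 * h = eta * (h * C) by rewrite /eta; field; rewrite gt_eqF.
  apply: le_trans (Hg _) _; first by apply: lt_le_trans kl _; rewrite ge_min lexx.
  by rewrite ler_wpM2l// ltW.
have E : h * 'D_u g w = 'D_k g w - a * 'D_A g w - b * 'D_B g w.
  by rewrite !deriveDv// !deriveZv//; rewrite /GRing.scale/=; ring.
rewrite -(ler_pM2l hp) -{1}(gtr0_norm hp) -normrM E.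
apply: le_trans (ler_normB _ _) _; apply: le_trans (lerD (ler_normB _ _) (lexx _)) _.
rewrite !normrM.
have e2 : d * h * M = e / 2 * h by rewrite /d; field; rewrite gt_eqF.
have dh : 0 < d * h by rewrite mulr_gt0.
have pA : `|a| * `|'D_A g w| <= d * h * `|'D_A g w| by rewrite ler_wpM2r.
have pB : `|b| * `|'D_B g w| <= d * h * `|'D_B g w| by rewrite ler_wpM2r.
apply: le_trans (lerD (lerD Hg pA) pB) _.
by move: e2 dh; rewrite /M; clear; lra.
Qed.

End Tangency.

(** * Covectors and the frame of the distribution *)

Section Covectors.
Context {R : realType}.
Local Notation E := 'rV[R]_8.
Implicit Types (a b u v w x : E) (al : @form1 R) (f : E -> R).

Lemma evC a v : ev a v = ev v a.
Proof. by apply: eq_bigr => i _; rewrite mulrC. Qed.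

Lemma evDr a u v : ev a (u + v) = ev a u + ev a v.
Proof. by rewrite -big_split; apply: eq_bigr => i _; rewrite mxE mulrDr. Qed.

Lemma evZr a (c : R) v : ev a (c *: v) = c * ev a v.
Proof. by rewrite /ev mulr_sumr; apply: eq_bigr => i _; rewrite mxE mulrCA. Qed.

Lemma evNr a v : ev a (- v) = - ev a v.
Proof. by rewrite -scaleN1r evZr mulN1r. Qed.

Lemma evBr a u v : ev a (u - v) = ev a u - ev a v.
Proof. by rewrite evDr evNr. Qed.

Lemma evDl a b v : ev (a + b) v = ev a v + ev b v.
Proof. by rewrite evC evDr !(evC v). Qed.

Lemma evZl (c : R) a v : ev (c *: a) v = c * ev a v.
Proof. by rewrite evC evZr (evC v). Qed.

Lemma evNl a v : ev (- a) v = - ev a v.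
Proof. by rewrite evC evNr (evC v). Qed.

Lemma evBl a b v : ev (a - b) v = ev a v - ev b v.
Proof. by rewrite evDl evNl. Qed.

Lemma ev_unitv i v : ev (unitv i) v = v 0 i.
Proof.
rewrite /ev (bigD1 i)//= big1 ?addr0 => [|j ji]; first by rewrite mxE !eqxx mul1r.
by rewrite mxE (negbTE ji) andbF mul0r.
Qed.

Lemma rowP8 u v : u 0 ix = v 0 ix -> u 0 iy = v 0 iy -> u 0 iz = v 0 iz ->
  u 0 ip = v 0 ip -> u 0 iq = v 0 iq -> u 0 ir = v 0 ir -> u 0 is_ = v 0 is_ ->
  u 0 it = v 0 it -> u = v.
Proof.
move=> *; apply/rowP => -[[|[|[|[|[|[|[|[|m]]]]]]]] h] //.
all: by rewrite (bool_irrelevance h isT).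
Qed.

Definition grad f x : E := \row_i 'D_(unitv i) f x.

Lemma ev_grad f x v : differentiable f x -> ev (grad f x) v = 'D_v f x.
Proof.
move=> df; rewrite [in RHS](row_sum_delta v) deriveE// linear_sum.
by apply: eq_bigr => i _; rewrite mxE linearZ /= -deriveE// mulrC.
Qed.

Lemma smooth_on_ev (V : normedModType R) (U : set V) (a b : V -> E) : open U ->
  smooth_on U a -> smooth_on U b -> smooth_on U (fun y => ev (a y) (b y)).
Proof.
move=> oU sa sb; apply: smooth_on_sum => // i.
by apply: smooth_onM => //; exact: smooth_on_coord.
Qed.

Lemma smooth_on_grad f : smooth_on setT f -> smooth_on setT (grad f).
Proof.
move=> sf; apply: smooth_on_mx; first exact: openT.
move=> i j; apply: smooth_on_eq (smooth_on_derive (unitv j) sf); first exact: openT.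
by move=> x _; rewrite mxE.
Qed.

Lemma differentiable_coordf (f : E -> E) x i :
  differentiable f x -> differentiable (fun y => f y 0 i) x.
Proof.
move=> df; have dc := @differentiable_coord R 1 8 (f x) 0 i.
exact: (differentiable_comp df dc).
Qed.

Lemma derive_coordf (f : E -> E) x u i : differentiable f x ->
  'D_u (fun y => f y 0 i) x = 'D_u f x 0 i.
Proof.
move=> df.
have lin : linear (fun M : E => M 0 i : R) by move=> a v w; rewrite !mxE.
pose lM := GRing.isLinear.Build _ _ _ _ _ lin.
pose L : {linear _ -> _} := HB.pack (fun M : E => M 0 i : R) lM.
by apply: (@derive_linl _ _ _ _ L) => //; exact: coord_continuous.
Qed.

Lemma differentiable_ev (a b : E -> E) x : differentiable a x -> differentiable b x ->
  differentiable (fun y => ev (a y) (b y)) x.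
Proof.
move=> da db.
have -> : (fun y => ev (a y) (b y)) =
    \sum_(i < 8) ((fun y => a y 0 i) * (fun y => b y 0 i)).
  by apply/funext => y; rewrite fct_sumE.
apply: differentiable_sum => i.
by apply: differentiableM; exact: differentiable_coordf.
Qed.

Lemma derive_ev (a b : E -> E) x u : differentiable a x -> differentiable b x ->
  'D_u (fun y => ev (a y) (b y)) x = ev ('D_u a x) (b x) + ev (a x) ('D_u b x).
Proof.
move=> da db.
have -> : (fun y => ev (a y) (b y)) =
    \sum_(i < 8) ((fun y => a y 0 i) * (fun y => b y 0 i)).
  by apply/funext => y; rewrite fct_sumE.
have dc (c : E -> E) i : differentiable c x -> derivable (fun y => c y 0 i) x u.
  by move=> dcx; apply: diff_derivable; exact: differentiable_coordf.
rewrite derive_sum => [|i]; last by apply: derivableM; exact: dc.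
rewrite -big_split; apply: eq_bigr => i _ /=.
rewrite deriveM; [|exact: dc..].
rewrite (derive_coordf u i da) (derive_coordf u i db) addrC.
by congr (_ + _); rewrite /GRing.scale/= mulrC.
Qed.

(** The pairing of the derivative of [grad f] along a with b is a second derivative of f, so d(df) =
    0 is the symmetry proved in [derive_comm]. *)
Lemma extd_grad f x u v : smooth_on setT f -> extd (grad f) x u v = 0.
Proof.
move=> sf; have dg : differentiable (grad f) x.
  exact: smooth_on_diff (smooth_on_grad sf) _.
have H a b : ev ('D_a (grad f) x) b = 'D_b ('D_a f) x.
  have db : differentiable ('D_a f) x.
    exact: smooth_on_diff (smooth_on_derive a sf) _.
  rewrite -ev_grad//; congr (ev _ _); apply/rowP => i.
  rewrite -(derive_coordf a i dg) [RHS]mxE -(derive_comm x a _ sf).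
  by congr ('D_a _ x); apply/funext => y; rewrite mxE.
have E : ev ('D_u (grad f) x) v = ev ('D_v (grad f) x) u.
  exact: etrans (H u v) (etrans (derive_comm x v u sf) (esym (H v u))).
by apply/eqP; rewrite /extd subr_eq0; apply/eqP; exact: E.
Qed.

Lemma derive_coordZ i (c : E) x u : 'D_u (fun w : E => w 0 i *: c) x = u 0 i *: c.
Proof.
have lin : linear (fun w : E => w 0 i *: c).
  by move=> a v w; rewrite !mxE scalerDl scalerA.
pose lM := GRing.isLinear.Build _ _ _ _ _ lin.
pose L : {linear _ -> _} := HB.pack (fun w : E => w 0 i *: c) lM.
have cL : continuous L.
  move=> y; have cy := @coord_continuous R 1 8 0 i y.
  exact: (@continuousZr_tmp _ E _ (fun w : E => w 0 i : R) c y cy).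
have dL : differentiable L x by exact: linear_differentiable.
by rewrite (deriveE u dL) (diff_lin x cL).
Qed.

Lemma differentiable_coordZ i (c : E) x : differentiable (fun w : E => w 0 i *: c) x.
Proof.
exact: (differentiableZl c (@differentiable_coord R 1 8 x 0 i)).
Qed.

End Covectors.

(** * The frame of the distribution at a point *)

Section Pointwise.
Context {R : realType}.
Local Notation E := 'rV[R]_8.
Implicit Types (f g b u v w x : E).

Lemma unitvE (i j : 'I_8) : (unitv i : E) 0 j = (nat_of_ord j == nat_of_ord i)%:R.
Proof. by rewrite mxE. Qed.

Definition vert (a b c : R) : E := a *: unitv ir + b *: unitv is_ + c *: unitv it.

Lemma ev_vert f (a b c : R) :
  ev f (vert a b c) = a * f 0 ir + b * f 0 is_ + c * f 0 it.
Proof. by rewrite /vert !evDr !evZr !(evC f) !ev_unitv. Qed.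

(** The 2 x 2 minors of the symbol matrix, signed as the components of a cross product. *)
Definition nr f g : R := f 0 is_ * g 0 it - f 0 it * g 0 is_.
Definition ns f g : R := f 0 it * g 0 ir - f 0 ir * g 0 it.
Definition nt f g : R := f 0 ir * g 0 is_ - f 0 is_ * g 0 ir.
(** Independence of the symbols is encoded as the non-vanishing of this one polynomial, which also
    serves as a denominator. *)
Definition nn f g : R := nr f g ^+ 2 + ns f g ^+ 2 + nt f g ^+ 2.

Definition vY f g : E := vert (nr f g) (ns f g) (nt f g).

(* [vA], [vB] are the vertical vectors dual to [f], [g] and orthogonal to [vY]:
   (g x n) / |n|^2 and (n x f) / |n|^2 for n = f x g on the (r,s,t) components. *)
Definition vA f g : E := (nn f g)^-1 *: vert
  (g 0 is_ * nt f g - g 0 it * ns f g)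
  (g 0 it * nr f g - g 0 ir * nt f g)
  (g 0 ir * ns f g - g 0 is_ * nr f g).

Definition vB f g : E := (nn f g)^-1 *: vert
  (ns f g * f 0 it - nt f g * f 0 is_)
  (nt f g * f 0 ir - nr f g * f 0 it)
  (nr f g * f 0 is_ - ns f g * f 0 ir).

(** The vertical correction that makes b tangent to the locus. Contact forms kill vertical vectors,
    so their values on b are kept. *)
Definition tlift f g b : E := b - ev f b *: vA f g - ev g b *: vB f g.

Definition base1 w : E := unitv ix + w 0 ip *: unitv iz + w 0 ir *: unitv ip
  + w 0 is_ *: unitv iq.
Definition base2 w : E := unitv iy + w 0 iq *: unitv iz + w 0 is_ *: unitv ip
  + w 0 it *: unitv iq.

Definition X1 f g w : E := tlift f g (base1 w).
Definition X2 f g w : E := tlift f g (base2 w).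

Definition Dspace f g w v : Prop :=
  [/\ ev f v = 0, ev g v = 0, ev (varpi0 w) v = 0, ev (varpi1 w) v = 0 &
      ev (varpi2 w) v = 0].

Lemma ev_varpi0 w v : ev (varpi0 w) v = v 0 iz - w 0 ip * v 0 ix - w 0 iq * v 0 iy.
Proof. by rewrite /varpi0 !evBl !evZl !ev_unitv. Qed.

Lemma ev_varpi1 w v : ev (varpi1 w) v = v 0 ip - w 0 ir * v 0 ix - w 0 is_ * v 0 iy.
Proof. by rewrite /varpi1 !evBl !evZl !ev_unitv. Qed.

Lemma ev_varpi2 w v : ev (varpi2 w) v = v 0 iq - w 0 is_ * v 0 ix - w 0 it * v 0 iy.
Proof. by rewrite /varpi2 !evBl !evZl !ev_unitv. Qed.

Lemma vert_coord (a b c : R) : [/\ vert a b c 0 ix = 0, vert a b c 0 iy = 0,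
  vert a b c 0 iz = 0, vert a b c 0 ip = 0 & vert a b c 0 iq = 0] /\
  [/\ vert a b c 0 ir = a, vert a b c 0 is_ = b & vert a b c 0 it = c].
Proof. by rewrite /vert !mxE /= !mulr0 !mulr1 !addr0 !add0r. Qed.

Lemma Dspace_lin f g w u v (a b : R) :
  Dspace f g w u -> Dspace f g w v -> Dspace f g w (a *: u + b *: v).
Proof.
move=> [u1 u2 u3 u4 u5] [v1 v2 v3 v4 v5].
by split; rewrite evDr !evZr ?u1 ?u2 ?u3 ?u4 ?u5 ?v1 ?v2 ?v3 ?v4 ?v5 !mulr0 addr0.
Qed.

(** For each i, vanishing minors turn b_i a - a_i b into a linear relation between the symbol rows;
    [symbol_regpts] plays it against row freeness. *)
Lemma cross_eq0 (a b : E) (i j : 'I_8) : nr a b = 0 -> ns a b = 0 -> nt a b = 0 ->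
  i \in [:: ir; is_; it] -> j \in [:: ir; is_; it] ->
  b 0 i * a 0 j + - a 0 i * b 0 j = 0.
Proof.
rewrite /nr /ns /nt !inE => r0 s0 t0.
by move=> /or3P[] /eqP-> /or3P[] /eqP->; lra.
Qed.

Section Frame.
Variables f g w : E.
Hypothesis nn0 : nn f g != 0.

Lemma ev_fA : ev f (vA f g) = 1.
Proof. by rewrite /vA evZr ev_vert; move: nn0; rewrite /nn /nr /ns /nt; move=> ?; field. Qed.

Lemma ev_gA : ev g (vA f g) = 0.
Proof. by rewrite /vA evZr ev_vert; ring. Qed.

Lemma ev_fB : ev f (vB f g) = 0.
Proof. by rewrite /vB evZr ev_vert; ring. Qed.

Lemma ev_gB : ev g (vB f g) = 1.
Proof. by rewrite /vB evZr ev_vert; move: nn0; rewrite /nn /nr /ns /nt; move=> ?; field. Qed.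

Lemma ev_fY : ev f (vY f g) = 0.
Proof. by rewrite /vY ev_vert /nr /ns /nt; ring. Qed.

Lemma ev_gY : ev g (vY f g) = 0.
Proof. by rewrite /vY ev_vert /nr /ns /nt; ring. Qed.

Lemma ev_f_lift b : ev f (tlift f g b) = 0.
Proof. by rewrite /tlift !evBr 2!evZr ev_fA ev_fB; ring. Qed.

Lemma ev_g_lift b : ev g (tlift f g b) = 0.
Proof. by rewrite /tlift !evBr 2!evZr ev_gA ev_gB; ring. Qed.

Lemma tlift_vert b : exists a1 a2 a3, tlift f g b = b + vert a1 a2 a3.
Proof.
(* The r, s and t components of the two corrections subtracted in [tlift]. *)
exists (- (ev f b * ((nn f g)^-1 * (g 0 is_ * nt f g - g 0 it * ns f g)))
  - ev g b * ((nn f g)^-1 * (ns f g * f 0 it - nt f g * f 0 is_))).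
exists (- (ev f b * ((nn f g)^-1 * (g 0 it * nr f g - g 0 ir * nt f g)))
  - ev g b * ((nn f g)^-1 * (nt f g * f 0 ir - nr f g * f 0 it))).
exists (- (ev f b * ((nn f g)^-1 * (g 0 ir * ns f g - g 0 is_ * nr f g)))
  - ev g b * ((nn f g)^-1 * (nr f g * f 0 is_ - ns f g * f 0 ir))).
rewrite /tlift -addrA; congr (_ + _); rewrite /vA /vB /vert.
move: (unitv ir) (unitv is_) (unitv it) (ev f b) (ev g b) => e1 e2 e3 p q.
by apply/rowP => i; rewrite !mxE; ring.
Qed.

Lemma varpi_vert (a b c : R) : [/\ ev (varpi0 w) (vert a b c) = 0,
  ev (varpi1 w) (vert a b c) = 0 & ev (varpi2 w) (vert a b c) = 0].
Proof.
have [[h1 h2 h3 h4 h5] _] := vert_coord a b c.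
by rewrite ev_varpi0 ev_varpi1 ev_varpi2 h1 h2 h3 h4 h5 !mulr0 !subr0.
Qed.

Lemma varpi_lift b : [/\ ev (varpi0 w) (tlift f g b) = ev (varpi0 w) b,
  ev (varpi1 w) (tlift f g b) = ev (varpi1 w) b &
  ev (varpi2 w) (tlift f g b) = ev (varpi2 w) b].
Proof.
have [a1 [a2 [a3 ->]]] := tlift_vert b.
by have [h0 h1 h2] := varpi_vert a1 a2 a3; rewrite (evDr (varpi0 w)) (evDr (varpi1 w)) (evDr (varpi2 w)) h0 h1 h2 !addr0.
Qed.

Lemma Dspace_X1 : Dspace f g w (X1 f g w).
Proof.
have [h0 h1 h2] := varpi_lift (base1 w).
split; rewrite ?ev_f_lift ?ev_g_lift ?h0 ?h1 ?h2 //.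
- by rewrite ev_varpi0 /base1 !mxE /=; ring.
- by rewrite ev_varpi1 /base1 !mxE /=; ring.
- by rewrite ev_varpi2 /base1 !mxE /=; ring.
Qed.

Lemma Dspace_X2 : Dspace f g w (X2 f g w).
Proof.
have [h0 h1 h2] := varpi_lift (base2 w).
split; rewrite ?ev_f_lift ?ev_g_lift ?h0 ?h1 ?h2 //.
- by rewrite ev_varpi0 /base2 !mxE /=; ring.
- by rewrite ev_varpi1 /base2 !mxE /=; ring.
- by rewrite ev_varpi2 /base2 !mxE /=; ring.
Qed.

Lemma Dspace_Y : Dspace f g w (vY f g).
Proof.
have [h0 h1 h2] := varpi_vert (nr f g) (ns f g) (nt f g).
by split; rewrite ?ev_fY ?ev_gY.
Qed.

Lemma X1_xy : X1 f g w 0 ix = 1 /\ X1 f g w 0 iy = 0.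
Proof.
rewrite /X1; have [a1 [a2 [a3 ->]]] := tlift_vert (base1 w).
have [[h1 h2 h3 h4 h5] _] := vert_coord a1 a2 a3.
by move: (vert a1 a2 a3) h1 h2 => v h1 h2; rewrite !mxE h1 h2 /= !mulr0 !addr0.
Qed.

Lemma X2_xy : X2 f g w 0 ix = 0 /\ X2 f g w 0 iy = 1.
Proof.
rewrite /X2; have [a1 [a2 [a3 ->]]] := tlift_vert (base2 w).
have [[h1 h2 h3 h4 h5] _] := vert_coord a1 a2 a3.
by move: (vert a1 a2 a3) h1 h2 => v h1 h2; rewrite !mxE h1 h2 /= !mulr0 !addr0.
Qed.

Lemma vY_coord : [/\ vY f g 0 ix = 0, vY f g 0 iy = 0, vY f g 0 ir = nr f g,
  vY f g 0 is_ = ns f g & vY f g 0 it = nt f g].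
Proof.
by have [[h1 h2 h3 h4 h5] [h6 h7 h8]] := vert_coord (nr f g) (ns f g) (nt f g).
Qed.

(** The contact equations leave only the r, s, t components, and a vector of 3-space orthogonal to
    both symbols is a multiple of their cross product. *)
Lemma vertical_span v : Dspace f g w v -> v 0 ix = 0 -> v 0 iy = 0 ->
  exists y, v = y *: vY f g.
Proof.
move=> [vf vg v0 v1 v2] vx vy.
have vz : v 0 iz = 0 by move: v0; rewrite ev_varpi0 vx vy !mulr0 !subr0.
have vp : v 0 ip = 0 by move: v1; rewrite ev_varpi1 vx vy !mulr0 !subr0.
have vq : v 0 iq = 0 by move: v2; rewrite ev_varpi2 vx vy !mulr0 !subr0.
have vE : v = vert (v 0 ir) (v 0 is_) (v 0 it).
  have [[h1 h2 h3 h4 h5] [h6 h7 h8]] := vert_coord (v 0 ir) (v 0 is_) (v 0 it).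
  by apply: rowP8; rewrite ?h1 ?h2 ?h3 ?h4 ?h5 ?h6 ?h7 ?h8.
move: vf vg; rewrite {1 2}vE !ev_vert; move: (v 0 ir) (v 0 is_) (v 0 it) vE.
move=> a b c -> Ef Eg.
set S := a * nr f g + b * ns f g + c * nt f g; exists (S / nn f g).
(* With n = f x g, this is one component of |n|^2 v = (v.n) n + (v.g) n x f - (v.f) n x g, that is,
   the expansion of n x (v x n). The last two terms vanish by [Ef] and [Eg]. *)
have H p q r1 r2 : p * nn f g = S * q + (a * g 0 ir + b * g 0 is_ + c * g 0 it) * r1
    - (a * f 0 ir + b * f 0 is_ + c * f 0 it) * r2 -> S / nn f g * q = p.
  rewrite Ef Eg !mul0r addr0 subr0 => h.
  by apply: (mulIf nn0); rewrite h mulrAC divfK.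
rewrite /vY /vert !scalerDr !scalerA.
rewrite (H a _ (ns f g * f 0 it - nt f g * f 0 is_) (ns f g * g 0 it - nt f g * g 0 is_));
  last by rewrite /S /nn /nr /ns /nt; ring.
rewrite (H b _ (nt f g * f 0 ir - nr f g * f 0 it) (nt f g * g 0 ir - nr f g * g 0 it));
  last by rewrite /S /nn /nr /ns /nt; ring.
rewrite (H c _ (nr f g * f 0 is_ - ns f g * f 0 ir) (nr f g * g 0 is_ - ns f g * g 0 ir)) //.
by rewrite /S /nn /nr /ns /nt; ring.
Qed.

(** The (x, y) components of [X1] and [X2] are (1, 0) and (0, 1), so subtracting them with the
    coefficients of v leaves a vertical vector. *)
Lemma Dspace_span v : Dspace f g w v ->
  exists y, v = v 0 ix *: X1 f g w + v 0 iy *: X2 f g w + y *: vY f g.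
Proof.
move=> vD; have [h1 h2] := X1_xy; have [h3 h4] := X2_xy.
pose u := 1 *: v + -1 *: (v 0 ix *: X1 f g w + v 0 iy *: X2 f g w).
have uD : Dspace f g w u.
  by apply: Dspace_lin => //; apply: Dspace_lin; [exact: Dspace_X1|exact: Dspace_X2].
have [||y uy] := vertical_span uD.
- by rewrite /u; move: (X1 f g w) (X2 f g w) h1 h3 => e1 e2 h1 h3;
    rewrite !mxE h1 h3; ring.
- by rewrite /u; move: (X1 f g w) (X2 f g w) h2 h4 => e1 e2 h2 h4;
    rewrite !mxE h2 h4; ring.
by exists y; rewrite -uy /u scale1r scaleN1r addrC subrK.
Qed.

Lemma Dspace_comb (a b c : R) : Dspace f g w (a *: X1 f g w + b *: X2 f g w + c *: vY f g).
Proof.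
rewrite -[_ + _]scale1r scale1r -[a *: _ + _]scale1r; apply: Dspace_lin; last exact: Dspace_Y.
by apply: Dspace_lin; [exact: Dspace_X1|exact: Dspace_X2].
Qed.

Lemma frame_inj (a b c : R) :
  a *: X1 f g w + b *: X2 f g w + c *: vY f g = 0 -> [/\ a = 0, b = 0 & c = 0].
Proof.
have [h1 h2] := X1_xy; have [h3 h4] := X2_xy; have [h5 h6 h7 h8 h9] := vY_coord.
have Y0 : vY f g != 0.
  apply/eqP => Y0; move/eqP: nn0; apply.
  by rewrite /nn -h7 -h8 -h9 Y0 !mxE; ring.
move: (X1 f g w) (X2 f g w) (vY f g) h1 h2 h3 h4 h5 h6 Y0 {h7 h8 h9}.
move=> e1 e2 e3 h1 h2 h3 h4 h5 h6 Y0 H.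
have a0 : a = 0.
  by move/rowP: (H) => /(_ ix); rewrite !mxE h1 h3 h5 !mulr0 mulr1 !addr0.
have b0 : b = 0.
  by move/rowP: (H) => /(_ iy); rewrite !mxE h2 h4 h6 !mulr0 mulr1 add0r addr0.
split => //; move: H; rewrite a0 b0 !scale0r !add0r => /eqP.
by rewrite scaler_eq0 (negbTE Y0) orbF => /eqP.
Qed.

(* The covector c0 varpi0 + c1 varpi1 + c2 varpi2 agrees with a on the tangent
   space as soon as a kills the distribution. *)
Lemma annihilator_span (a v : E) : (forall u, Dspace f g w u -> ev a u = 0) ->
  ev f v = 0 -> ev g v = 0 ->
  ev a v = ev a (tlift f g (unitv iz)) * ev (varpi0 w) v
    + ev a (tlift f g (unitv ip)) * ev (varpi1 w) v
    + ev a (tlift f g (unitv iq)) * ev (varpi2 w) v.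
Proof.
move=> aD fv gv.
(* On the tangent space the lifts of the z, p and q directions are dual to the contact forms, so [u]
   lies in the distribution and is killed by a. *)
pose u := v - (ev (varpi0 w) v *: tlift f g (unitv iz) +
  ev (varpi1 w) v *: tlift f g (unitv ip) + ev (varpi2 w) v *: tlift f g (unitv iq)).
have H (c : E) : ev c u = ev c v - (ev (varpi0 w) v * ev c (tlift f g (unitv iz)) +
    ev (varpi1 w) v * ev c (tlift f g (unitv ip)) +
    ev (varpi2 w) v * ev c (tlift f g (unitv iq))).
  rewrite /u; move: (tlift f g _) (tlift f g _) (tlift f g _) => e1 e2 e3.
  by rewrite evBr !evDr !evZr.
apply/eqP; rewrite -subr_eq0 -(aD u); first by rewrite H; apply/eqP; ring.
have [z0 z1 z2] := varpi_lift (unitv iz).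
have [p0 p1 p2] := varpi_lift (unitv ip).
have [q0 q1 q2] := varpi_lift (unitv iq).
split; rewrite H.
- by rewrite !ev_f_lift fv; ring.
- by rewrite !ev_g_lift gv; ring.
- by rewrite z0 p0 q0 !ev_varpi0 !unitvE /=; ring.
- by rewrite z1 p1 q1 !ev_varpi1 !unitvE /=; ring.
- by rewrite z2 p2 q2 !ev_varpi2 !unitvE /=; ring.
Qed.

End Frame.
End Pointwise.

Section SmoothMatrices.
Context {R : realType} {V : normedModType R}.
Implicit Types (U : set V).

Lemma smooth_onZ m n U (f : V -> R) (g : V -> 'M[R]_(m, n)) : open U ->
  smooth_on U f -> smooth_on U g -> smooth_on U (fun x => f x *: g x).
Proof.
move=> oU sf sg; apply: smooth_on_mx => // i j.
apply: (smooth_on_eq oU _ (smooth_onM oU sf (smooth_on_coord i j oU sg))).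
by move=> x _; rewrite mxE.
Qed.

Lemma smooth_onNmx m n U (g : V -> 'M[R]_(m, n)) : open U ->
  smooth_on U g -> smooth_on U (fun x => - g x).
Proof.
move=> oU sg; have c : smooth_on U (fun=> -1 : R) by exact: smooth_on_cst.
apply: (smooth_on_eq oU _ (smooth_onZ oU c sg)).
by move=> x _; rewrite scaleN1r.
Qed.

Lemma open_neq0 (f : V -> R) : continuous f -> open [set x | f x != 0].
Proof.
move=> cf; apply: (@open_comp _ _ f [set y | y != 0]); last exact: open_neq.
by move=> x _; exact: cf.
Qed.

End SmoothMatrices.

(** * Smoothness of the frame, brackets, and forms killing the distribution *)

Section System.
Context {R : realType}.
Local Notation E := 'rV[R]_8.
Variables F G : E -> R.
Hypotheses (sF : smooth_on setT F) (sG : smooth_on setT G).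
Implicit Types (u v w x : E).

Local Notation f := (grad F).
Local Notation g := (grad G).

Let dF x : differentiable F x. Proof. exact: smooth_on_diff sF _. Qed.
Let dG x : differentiable G x. Proof. exact: smooth_on_diff sG _. Qed.

Definition regpts : set E := [set x | nn (f x) (g x) != 0].

Lemma smooth_nrst U : open U -> [/\ smooth_on U (fun x => nr (f x) (g x)),
   smooth_on U (fun x => ns (f x) (g x)) & smooth_on U (fun x => nt (f x) (g x))].
Proof.
move=> oU.
have sf i : smooth_on U (fun x => f x 0 i).
  by apply: smooth_on_coord => //; exact: smooth_on_sub (smooth_on_grad sF).
have sg i : smooth_on U (fun x => g x 0 i).
  by apply: smooth_on_coord => //; exact: smooth_on_sub (smooth_on_grad sG).
by split; (apply: smooth_onD => //; [|apply: smooth_onN => //]); exact: smooth_onM.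
Qed.

Lemma smooth_nn U : open U -> smooth_on U (fun x => nn (f x) (g x)).
Proof.
move=> oU; have [sr ss st] := smooth_nrst oU.
by apply: smooth_onD => //; [apply: smooth_onD => //|]; exact: smooth_onM.
Qed.

Lemma open_regpts : open regpts.
Proof.
apply: open_neq0 => x; apply: differentiable_continuous.
exact: smooth_on_diff (smooth_nn openT) _.
Qed.

Lemma smooth_vert U (a b c : E -> R) : open U -> smooth_on U a -> smooth_on U b ->
  smooth_on U c -> smooth_on U (fun x => vert (a x) (b x) (c x)).
Proof.
move=> oU sa sb sc; apply: smooth_onD => //; last exact: smooth_onZl.
by apply: smooth_onD => //; exact: smooth_onZl.
Qed.

Lemma smooth_vY : smooth_on regpts (fun x => vY (f x) (g x)).
Proof.
have [sr ss st] := smooth_nrst open_regpts.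
by apply: smooth_vert => //; exact: open_regpts.
Qed.

Lemma smooth_lift (b : E -> E) : smooth_on regpts b ->
  smooth_on regpts (fun x => tlift (f x) (g x) (b x)).
Proof.
move=> sb; have oU := open_regpts; have [sr ss st] := smooth_nrst oU.
have sf : smooth_on regpts f by exact: smooth_on_sub (smooth_on_grad sF).
have sg : smooth_on regpts g by exact: smooth_on_sub (smooth_on_grad sG).
have sfi i : smooth_on regpts (fun x => f x 0 i) by exact: smooth_on_coord.
have sgi i : smooth_on regpts (fun x => g x 0 i) by exact: smooth_on_coord.
have sV : smooth_on regpts (fun x => (nn (f x) (g x))^-1).
  by apply: smooth_onV => //; exact: smooth_nn.
have sA : smooth_on regpts (fun x => vA (f x) (g x)).
  apply: smooth_onZ => //; apply: smooth_vert => //;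
  (apply: smooth_onD => //; [|apply: smooth_onN => //]); exact: smooth_onM.
have sB : smooth_on regpts (fun x => vB (f x) (g x)).
  apply: smooth_onZ => //; apply: smooth_vert => //;
  (apply: smooth_onD => //; [|apply: smooth_onN => //]); exact: smooth_onM.
apply: smooth_onD => //; last first.
  by apply: smooth_onNmx => //; apply: smooth_onZ => //; exact: smooth_on_ev.
apply: smooth_onD => //.
by apply: smooth_onNmx => //; apply: smooth_onZ => //; exact: smooth_on_ev.
Qed.

Lemma smooth_base (i j k l m n o : 'I_8) : smooth_on regpts (fun w : E =>
  unitv i + w 0 j *: unitv k + w 0 l *: unitv m + w 0 n *: unitv o : E).
Proof.
have oU := open_regpts.
have sw i' : smooth_on regpts (fun w : E => w 0 i').
  by apply: (@smooth_on_coord _ _ _ _ _ id) => //; exact: smooth_on_id.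
do 3?[apply: smooth_onD => //; last exact: smooth_onZl].
exact: smooth_on_cst.
Qed.

Lemma smooth_X1 : smooth_on regpts (fun x => X1 (f x) (g x) x).
Proof. by apply: smooth_lift; exact: smooth_base. Qed.

Lemma smooth_X2 : smooth_on regpts (fun x => X2 (f x) (g x) x).
Proof. by apply: smooth_lift; exact: smooth_base. Qed.

Lemma tangentP x v : tangent F G x v <-> ev (f x) v = 0 /\ ev (g x) v = 0.
Proof. by rewrite !ev_grad. Qed.

Lemma DsysP x v : Dsys F G x v <-> Dspace (f x) (g x) x v.
Proof.
split=> [[/tangentP[h1 h2] H]|[h1 h2 h3 h4 h5]].
  by split=> //; [exact: (H 0%N)|exact: (H 1%N)|exact: (H 2%N)].
by split; [exact/tangentP|case=> [|[|[|]]]].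
Qed.

Lemma derive_tangent_locus (h : E -> R) w u : locus F G w -> regpts w ->
  tangent F G w u -> differentiable h w ->
  (\near w, locus F G w -> h w = 0) -> 'D_u h w = 0.
Proof.
move=> [Fw Gw] rw [uF uG] dh h0.
have cF v : {for w, continuous ('D_v F)}.
  by apply: differentiable_continuous; exact: smooth_on_diff (smooth_on_derive v sF) _.
have cG v : {for w, continuous ('D_v G)}.
  by apply: differentiable_continuous; exact: smooth_on_diff (smooth_on_derive v sG) _.
(* At a regular point the vertical dual vectors are the directions along which (F, G) has the
   identity as derivative. *)
apply: (derive_tangent0 (A := vA (f w) (g w)) (B := vB (f w) (g w)) dF dG cF cG Fw Gw
  _ _ _ _ uF uG dh).
- by rewrite -ev_grad//; exact: ev_fA.
- by rewrite -ev_grad//; exact: ev_fB.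
- by rewrite -ev_grad//; exact: ev_gA.
- by rewrite -ev_grad//; exact: ev_gB.
- by apply: filterS h0 => x hx Fx Gx; exact: hx.
Qed.

(** Differentiate a(Y) = 0 along u and a(X) = 0 along v, then subtract. Both equations hold on the
    locus only, hence the tangency of u and v; ['D_u Y w - 'D_v X w] is the Lie bracket at w. *)
Lemma extd_bracket (a : @form1 R) (X Y : E -> E) w u v : locus F G w -> regpts w ->
  X w = u -> Y w = v -> tangent F G w u -> tangent F G w v ->
  differentiable a w -> differentiable X w -> differentiable Y w ->
  (\near w, locus F G w -> ev (a w) (X w) = 0) ->
  (\near w, locus F G w -> ev (a w) (Y w) = 0) ->
  extd a w u v = - ev (a w) ('D_u Y w - 'D_v X w).
Proof.
move=> lw rw Xw Yw tX tY da dX dY aX aY.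
have := derive_tangent_locus lw rw tX (differentiable_ev da dY) aY.
have := derive_tangent_locus lw rw tY (differentiable_ev da dX) aX.
rewrite (derive_ev v da dX) (derive_ev u da dY) Xw Yw => H1 H2.
have alg (p q r s : R) : p + s = 0 -> q + r = 0 -> q - p = - (r - s).
  by move=> /eqP; rewrite addr_eq0 => /eqP-> /eqP; rewrite addr_eq0 => /eqP->; ring.
by rewrite /extd evBr; exact: alg H1 H2.
Qed.

(** Constant coefficients in the frame extend any vector of D(w) to a smooth section of D. *)
Definition field (a b c : R) : E -> E := fun x =>
  a *: X1 (f x) (g x) x + b *: X2 (f x) (g x) x + c *: vY (f x) (g x).

Lemma smooth_field (a b c : R) : smooth_on regpts (field a b c).
Proof.
have oU := open_regpts.
have sc (d : R) : smooth_on regpts (fun=> d : R) by exact: smooth_on_cst.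
apply: smooth_onD => //; last by apply: smooth_onZ => //; exact: smooth_vY.
by apply: smooth_onD => //; apply: smooth_onZ => //; [exact: smooth_X1|exact: smooth_X2].
Qed.

Lemma differentiable_varpi w : [/\ differentiable (@varpi0 R) w,
  differentiable (@varpi1 R) w & differentiable (@varpi2 R) w].
Proof.
have H (i j k l m : 'I_8) : differentiable (fun w : E =>
    unitv i - w 0 j *: unitv k - w 0 l *: unitv m : E) w.
  have dj := @differentiable_coordZ R j (unitv k) w.
  have dl := @differentiable_coordZ R l (unitv m) w.
  have dc := differentiable_cst (unitv i : E) w.
  exact: (differentiableB (differentiableB dc dj) dl).
by split; exact: H.
Qed.

Lemma extd_form (i j k l m : 'I_8) w u v :
  extd (fun w : E => unitv i - w 0 j *: unitv k - w 0 l *: unitv m : E) w u v =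
  v 0 j * u 0 k + v 0 l * u 0 m - (u 0 j * v 0 k + u 0 l * v 0 m).
Proof.
have D z : 'D_z (fun w : E => unitv i - w 0 j *: unitv k - w 0 l *: unitv m : E) w =
    - (z 0 j *: unitv k + z 0 l *: unitv m).
  have dj := @differentiable_coordZ R j (unitv k) w.
  have dl := @differentiable_coordZ R l (unitv m) w.
  have dc := differentiable_cst (unitv i : E) w.
  have dcj := differentiableB dc dj.
  have -> : (fun w : E => unitv i - w 0 j *: unitv k - w 0 l *: unitv m : E) =
    cst (unitv i) - (fun w : E => w 0 j *: unitv k) - (fun w : E => w 0 l *: unitv m).
    by [].
  rewrite (deriveB (diff_derivable dcj) (diff_derivable dl)).
  rewrite (deriveB (diff_derivable dc) (diff_derivable dj)).
  by rewrite derive_cst !derive_coordZ sub0r opprD.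
by rewrite /extd !D !evNl !evDl !evZl !ev_unitv; ring.
Qed.

Lemma extd_varpi0 w u v : extd (@varpi0 R) w u v =
  v 0 ip * u 0 ix + v 0 iq * u 0 iy - (u 0 ip * v 0 ix + u 0 iq * v 0 iy).
Proof. exact: extd_form. Qed.

Lemma extd_varpi1 w u v : extd (@varpi1 R) w u v =
  v 0 ir * u 0 ix + v 0 is_ * u 0 iy - (u 0 ir * v 0 ix + u 0 is_ * v 0 iy).
Proof. exact: extd_form. Qed.

Lemma extd_varpi2 w u v : extd (@varpi2 R) w u v =
  v 0 is_ * u 0 ix + v 0 it * u 0 iy - (u 0 is_ * v 0 ix + u 0 it * v 0 iy).
Proof. exact: extd_form. Qed.

(** On D one has dp = r dx + s dy and dq = s dx + t dy, and the two s terms of dx /\ dp + dy /\ dq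
    cancel. *)
Lemma extd_varpi0_D w u v : Dspace (f w) (g w) w u -> Dspace (f w) (g w) w v ->
  extd (@varpi0 R) w u v = 0.
Proof.
move=> [_ _ _ + +] [_ _ _ + +]; rewrite extd_varpi0 !ev_varpi1 !ev_varpi2.
move=> u1 u2 v1 v2.
have -> : u 0 ip = w 0 ir * u 0 ix + w 0 is_ * u 0 iy by lra.
have -> : u 0 iq = w 0 is_ * u 0 ix + w 0 it * u 0 iy by lra.
have -> : v 0 ip = w 0 ir * v 0 ix + w 0 is_ * v 0 iy by lra.
have -> : v 0 iq = w 0 is_ * v 0 ix + w 0 it * v 0 iy by lra.
by ring.
Qed.

(* On fields X, Y of the distribution a form a that kills it satisfies
   da(X, Y) = - a([X, Y]); the bracket is tangent to the locus, where a is a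
   combination of the contact forms. *)
Lemma extd_annihilator (a : @form1 R) w : locus F G w -> regpts w ->
  differentiable a w ->
  (\near w, locus F G w -> forall v, Dsys F G w v -> ev (a w) v = 0) ->
  exists c0 c1 c2 : R,
    (forall v, tangent F G w v -> ev (a w) v =
       c0 * ev (varpi0 w) v + c1 * ev (varpi1 w) v + c2 * ev (varpi2 w) v) /\
    (forall u v, Dsys F G w u -> Dsys F G w v ->
       extd a w u v = c1 * extd varpi1 w u v + c2 * extd varpi2 w u v).
Proof.
move=> lw rw da a0.
have aw u : Dspace (f w) (g w) w u -> ev (a w) u = 0.
  by move=> /DsysP; exact: (nbhs_singleton a0 lw).
exists (ev (a w) (tlift (f w) (g w) (unitv iz))), (ev (a w) (tlift (f w) (g w) (unitv ip))),
  (ev (a w) (tlift (f w) (g w) (unitv iq))).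
have aE v : tangent F G w v -> ev (a w) v =
    ev (a w) (tlift (f w) (g w) (unitv iz)) * ev (varpi0 w) v +
    ev (a w) (tlift (f w) (g w) (unitv ip)) * ev (varpi1 w) v +
    ev (a w) (tlift (f w) (g w) (unitv iq)) * ev (varpi2 w) v.
  by move=> /tangentP[h1 h2]; exact: annihilator_span.
split=> // u v /DsysP uD /DsysP vD.
have [yu Eu] := Dspace_span rw uD; have [yv Ev] := Dspace_span rw vD.
pose X := field (u 0 ix) (u 0 iy) yu; pose Y := field (v 0 ix) (v 0 iy) yv.
have Xw : X w = u by rewrite [RHS]Eu.
have Yw : Y w = v by rewrite [RHS]Ev.
have nearreg : \near w, regpts w by exact: (open_nbhs_nbhs (conj open_regpts rw)).
have fD p q r x : regpts x -> Dsys F G x (field p q r x).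
  by move=> rx; apply/DsysP; exact: Dspace_comb.
have dfield p q r : differentiable (field p q r) w.
  exact: smooth_on_diff (smooth_field p q r) rw.
have tu : tangent F G w u by apply/tangentP; have [] := uD.
have tv : tangent F G w v by apply/tangentP; have [] := vD.
have br (b : @form1 R) : differentiable b w ->
    (\near w, locus F G w -> forall v, Dsys F G w v -> ev (b w) v = 0) ->
    extd b w u v = - ev (b w) ('D_u Y w - 'D_v X w).
  move=> db b0; apply: (extd_bracket lw rw Xw Yw tu tv db (dfield _ _ _) (dfield _ _ _)).
    by apply: filterS2 nearreg b0 => x rx bx lx; exact: (bx lx _ (fD _ _ _ _ rx)).
  by apply: filterS2 nearreg b0 => x rx bx lx; exact: (bx lx _ (fD _ _ _ _ rx)).
have all0 (b : @form1 R) : (forall x v, Dsys F G x v -> ev (b x) v = 0) ->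
    \near w, locus F G w -> forall v, Dsys F G w v -> ev (b w) v = 0.
  by move=> H; apply: filterS nearreg => x _ _ z; exact: H.
have [d0 d1 d2] := differentiable_varpi w.
have b0 := br _ d0 (all0 _ (fun x z h => let: conj _ H := h in H 0%N isT)).
have b1 := br _ d1 (all0 _ (fun x z h => let: conj _ H := h in H 1%N isT)).
have b2 := br _ d2 (all0 _ (fun x z h => let: conj _ H := h in H 2%N isT)).
(* The differentials of F and G kill D and are closed, so they vanish on the bracket. The bracket is
   thus tangent to the locus, and [aE] applies to it. *)
have bf : extd f w u v = - ev (f w) ('D_u Y w - 'D_v X w).
  apply: br; first exact: smooth_on_diff (smooth_on_grad sF) _.
  by apply: all0 => x z [/tangentP[]].
have bg : extd g w u v = - ev (g w) ('D_u Y w - 'D_v X w).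
  apply: br; first exact: smooth_on_diff (smooth_on_grad sG) _.
  by apply: all0 => x z [/tangentP[]].
have ba := br _ da a0.
move: b0 b1 b2 bf bg ba; move: ('D_u Y w - _) => Z.
rewrite (extd_grad w u v sF) (extd_grad w u v sG) (extd_varpi0_D uD vD).
move=> b0 b1 b2 bf bg ->; rewrite b1 b2 aE; last first.
  by apply/tangentP; split; apply: oppr_inj; rewrite oppr0.
(* This follows from d varpi0 = 0 on D, and it removes the coefficient [c0] from the formula. *)
have -> : ev (varpi0 w) Z = 0 by apply: oppr_inj; rewrite oppr0.
ring.
Qed.

End System.

(** * Planes in a 3-space and alternating forms *)

Section AlternatingForms.
Context {K : fieldType} {L : vectType K}.
Implicit Types (u v k e : L) (V D : {vspace L}).

Definition altform (be : L -> L -> K) : Prop :=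
  [/\ forall a u1 u2 v, be (a *: u1 + u2) v = a * be u1 v + be u2 v,
      forall u v, be u v = - be v u & forall u, be u u = 0].

Variables (be : L -> L -> K).
Hypothesis alt : altform be.

Lemma altDl (a : K) u1 u2 v : be (a *: u1 + u2) v = a * be u1 v + be u2 v.
Proof. by case: alt. Qed.

Lemma altC u v : be u v = - be v u.
Proof. by case: alt. Qed.

Lemma altuu u : be u u = 0.
Proof. by case: alt. Qed.

Lemma altDr (a : K) u v1 v2 : be u (a *: v1 + v2) = a * be u v1 + be u v2.
Proof. by rewrite altC altDl opprD -mulrN -!(altC u). Qed.

Lemma alt0l v : be 0 v = 0.
Proof.
have := altDl 1 0 0 v; rewrite scaler0 addr0 mul1r => /eqP.
by rewrite -subr_eq0 opprD addrA subrr sub0r oppr_eq0 => /eqP.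
Qed.

Lemma altZl (a : K) u v : be (a *: u) v = a * be u v.
Proof. by rewrite -[a *: u]addr0 altDl alt0l addr0. Qed.

Lemma altZr (a : K) u v : be u (a *: v) = a * be u v.
Proof. by rewrite altC altZl -mulrN -altC. Qed.

Lemma alt_plane_eq0 (u v w1 w2 : L) : be u v = 0 -> w1 \in <<[:: u; v]>>%VS ->
  w2 \in <<[:: u; v]>>%VS -> be w1 w2 = 0.
Proof.
move=> uv; rewrite !span_cons span_nil addv0.
move=> /memv_addP[_ /vlineP[a ->] [_ /vlineP[b ->] ->]].
move=> /memv_addP[_ /vlineP[c ->] [_ /vlineP[d ->] ->]].
rewrite altDl altZl !altDr !altZr !altuu (altC v u) uv; ring.
Qed.

(* A plane missing the kernel vector k would span D together with k, forcing
   the form to vanish on D. *)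
Lemma kernel_in_plane V D k : (V <= D)%VS -> \dim V = 2%N -> \dim D = 3%N ->
  k \in D -> (forall v, v \in D -> be k v = 0) ->
  (forall u v, u \in V -> v \in V -> be u v = 0) ->
  (exists u v, [/\ u \in D, v \in D & be u v != 0]) -> k \in V.
Proof.
move=> VD dV dD kD bk bV [u [v [uD vD]]]; apply: contraNT => kV.
have k0 : k != 0 by apply: contraNneq kV => ->; rewrite mem0v.
have VkD : (V + <[k]>)%VS = D.
  apply/eqP; rewrite eqEdim subv_add VD -memvE kD /= dD.
  rewrite dimv_disjoint_sum ?dV ?dim_vline ?k0//.
  apply/eqP; rewrite -subv0; apply/subvP => x; rewrite memv_cap => /andP[xV].
  move=> /vlineP[c xE]; rewrite memv0 xE.
  have [->|c0] := eqVneq c 0; first by rewrite scale0r.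
  by case/negP: kV; rewrite -[k](scalerK c0) -xE; exact: memvZ.
have dec x : x \in D -> exists2 y, y \in V & exists c : K, x = c *: k + y.
  rewrite -VkD => /memv_addP[y yV [_ /vlineP[c ->] ->]].
  by exists y => //; exists c; rewrite addrC.
have [u1 u1V [c uE]] := dec _ uD; have [v1 v1V [d vE]] := dec _ vD.
rewrite uE altDl bk// mulr0 add0r vE altDr (altC u1) bk ?oppr0 ?mulr0 ?add0r.
  by rewrite bV.
exact: subvP u1V.
Qed.

Section Frame.
Variables (e1 e2 e3 : L).

Definition lincomb (a b c : K) : L := a *: e1 + b *: e2 + c *: e3.

Lemma alt_comb (a b c a' b' c' : K) : be (lincomb a b c) (lincomb a' b' c') =
  be e2 e3 * (b * c' - c * b') - be e1 e3 * (c * a' - a * c') +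
  be e1 e2 * (a * b' - b * a').
Proof.
rewrite /lincomb -!addrA !altDl !altZl !altDr !altZr !altuu.
rewrite (altC e2 e1) (altC e3 e1) (altC e3 e2); ring.
Qed.

(** By [alt_comb] the form is the determinant with this vector as first row, which is why it lies in
    the kernel. It is polynomial in the coefficients of the form, hence smooth in the base point. *)
Definition kervec : L := lincomb (be e2 e3) (- be e1 e3) (be e1 e2).

Lemma be_kervec (a b c : K) : be kervec (lincomb a b c) = 0.
Proof. by rewrite alt_comb; ring. Qed.

End Frame.

End AlternatingForms.

Section TwoForms.
Context {K : fieldType} {L : vectType K}.
Variables (be1 be2 : L -> L -> K) (e1 e2 e3 : L).
Hypotheses (alt1 : altform be1) (alt2 : altform be2).
Hypothesis free_e : free [:: e1; e2; e3].
Implicit Types (V : {vspace L}).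

Local Notation D := <<[:: e1; e2; e3]>>%VS.
Local Notation comb := (lincomb e1 e2 e3).
Local Notation ker1 := (kervec be1 e1 e2 e3).
Local Notation ker2 := (kervec be2 e1 e2 e3).

Lemma mem_frame v : v \in D <-> exists a b c, v = comb a b c.
Proof.
rewrite !span_cons span_nil addv0 addvA; split.
  move=> /memv_addP[_ /memv_addP[_ /vlineP[a ->] [_ /vlineP[b ->] ->]] [_ /vlineP[c ->] ->]].
  by exists a, b, c.
by move=> [a [b [c ->]]]; rewrite !memv_add// memvZ// memv_line.
Qed.

Lemma dim_frame : \dim D = 3%N.
Proof. by move: free_e => /eqP. Qed.

Lemma frame_comb0 (a b c : K) : comb a b c = 0 -> [/\ a = 0, b = 0 & c = 0].
Proof.
move=> E; pose k i := nth 0 [:: a; b; c] i.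
have /freeP := free_e => /(_ (fun i : 'I_3 => k i)).
rewrite !big_ord_recl big_ord0 /k /= addr0 addrA => /(_ E) H.
by split; [exact: (H 0)|exact: (H 1)|exact: (H 2%:R)].
Qed.

Lemma kervec_mem (be : L -> L -> K) : kervec be e1 e2 e3 \in D.
Proof. by apply/mem_frame; do 3!eexists. Qed.

Lemma kervec_ker (be : L -> L -> K) v : altform be -> v \in D ->
  be (kervec be e1 e2 e3) v = 0.
Proof. by move=> alt /mem_frame[a [b [c ->]]]; exact: be_kervec. Qed.

Lemma kervec_neq0 (be : L -> L -> K) : kervec be e1 e2 e3 != 0 ->
  exists u v, [/\ u \in D, v \in D & be u v != 0].
Proof.
have m1 : e1 \in D by apply: memv_span; rewrite !inE eqxx.
have m2 : e2 \in D by apply: memv_span; rewrite !inE eqxx orbT.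
have m3 : e3 \in D by apply: memv_span; rewrite !inE eqxx !orbT.
have [b23|] := eqVneq (be e2 e3) 0; last by exists e2, e3.
have [b13|] := eqVneq (be e1 e3) 0; last by exists e1, e3.
have [b12|] := eqVneq (be e1 e2) 0; last by exists e1, e2.
by rewrite /kervec /lincomb b23 b13 b12 oppr0 !scale0r !addr0 eqxx.
Qed.

Lemma plane_kervec (be : L -> L -> K) V : altform be -> kervec be e1 e2 e3 != 0 ->
  (V <= D)%VS -> \dim V = 2%N -> (forall u v, u \in V -> v \in V -> be u v = 0) ->
  kervec be e1 e2 e3 \in V.
Proof.
move=> alt k0 VD dV bV.
apply: (kernel_in_plane alt VD dV dim_frame (kervec_mem be)) => //.
  by move=> v; exact: kervec_ker.
exact: kervec_neq0.
Qed.

(** V has a basis k, m with k the kernel vector, and an alternating form on a plane is determined by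
    its value on a basis, here 0. *)
Lemma kervec_plane (be : L -> L -> K) V : altform be -> kervec be e1 e2 e3 != 0 ->
  (V <= D)%VS -> \dim V = 2%N -> kervec be e1 e2 e3 \in V ->
  forall u v, u \in V -> v \in V -> be u v = 0.
Proof.
set k := kervec be e1 e2 e3 => alt k0 VD dV kV.
have /subvPn[m mV mk] : ~~ (V <= <[k]>)%VS.
  by apply/negP => /dimvS; rewrite dV dim_vline; case: (k == 0).
have VE : V = <<[:: k; m]>>%VS.
  apply/eqP; rewrite eq_sym eqEdim dV; apply/andP; split.
    by apply/span_subvP => x; rewrite !inE => /orP[] /eqP->.
  have : free [:: k; m].
    rewrite free_cons span_seq1 seq1_free; apply/andP; split.
      apply: contra mk => /vlineP[c kE]; have c0 : c != 0.
        by apply: contraNneq k0 => c0; rewrite kE c0 scale0r.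
      by apply/vlineP; exists c^-1; rewrite kE scalerK.
    by apply: contraNneq mk => ->; rewrite mem0v.
  by move=> /eqP /= ->.
move=> u v; rewrite VE; apply: alt_plane_eq0 => //.
by apply: kervec_ker => //; exact: (subvP VD).
Qed.

Definition forms_indep : Prop := forall l m : K,
  (forall u v, u \in D -> v \in D -> l * be1 u v + m * be2 u v = 0) -> l = 0 /\ m = 0.

(** The kernel vector depends linearly on the form, and by [alt_comb] it determines the form on D; a
    relation between kernel vectors is therefore one between forms. *)
Lemma kervec_free : forms_indep -> free [:: ker1; ker2].
Proof.
move=> ind; have H l m : l *: ker1 + m *: ker2 = 0 -> l = 0 /\ m = 0.
  move=> E; apply: ind => u v /mem_frame[a [b [c ->]]] /mem_frame[a' [b' [c' ->]]].
  rewrite !alt_comb//.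
  have : comb (l * be1 e2 e3 + m * be2 e2 e3) (- (l * be1 e1 e3 + m * be2 e1 e3))
      (l * be1 e1 e2 + m * be2 e1 e2) = 0.
    rewrite -E /kervec /lincomb !scalerDr !scalerA.
    rewrite !scalerDl opprD !scalerDl !mulrN !scaleNr.
    by rewrite [RHS]addrACA; congr (_ + _); rewrite addrACA.
  move=> /frame_comb0[E1 /eqP]; rewrite oppr_eq0 => /eqP E2 E3.
  rewrite [X in X = 0](_ : _ = (l * be1 e2 e3 + m * be2 e2 e3) * (b * c' - c * b')
    - (l * be1 e1 e3 + m * be2 e1 e3) * (c * a' - a * c')
    + (l * be1 e1 e2 + m * be2 e1 e2) * (a * b' - b * a')).
    by rewrite E1 E2 E3 !mul0r subr0 addr0.
  ring.
have k10 : ker1 != 0.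
  by apply/eqP => k1; have [] := H 1 0; rewrite ?k1 ?scaler0 ?scale0r ?addr0// => /eqP;
    rewrite oner_eq0.
have k20 : ker2 != 0.
  by apply/eqP => k2; have [] := H 0 1; rewrite ?k2 ?scaler0 ?scale0r ?addr0// => _ /eqP;
    rewrite oner_eq0.
rewrite free_cons span_seq1 seq1_free k20 andbT; apply/negP => /vlineP[c kE].
have [] := H 1 (- c); first by rewrite scale1r scaleNr kE subrr.
by move=> /eqP; rewrite oner_eq0.
Qed.

Lemma unique_plane V : forms_indep ->
  [/\ (V <= D)%VS, \dim V = 2%N, (forall u v, u \in V -> v \in V -> be1 u v = 0) &
      (forall u v, u \in V -> v \in V -> be2 u v = 0)] <->
  V = <<[:: ker1; ker2]>>%VS.
Proof.
move=> ind; have fr := kervec_free ind.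
have k10 : ker1 != 0 by apply: (free_not0 fr); rewrite inE eqxx.
have k20 : ker2 != 0 by apply: (free_not0 fr); rewrite !inE eqxx orbT.
have d2 : \dim <<[:: ker1; ker2]>>%VS = 2%N by move: fr => /eqP.
have KD : (<<[:: ker1; ker2]>> <= D)%VS.
  by apply/span_subvP => x; rewrite !inE => /orP[] /eqP->; exact: kervec_mem.
split=> [[VD dV b1 b2]|->].
  apply/eqP; rewrite eq_sym eqEdim dV d2 andbT.
  apply/span_subvP => x; rewrite !inE => /orP[] /eqP->.
    exact: plane_kervec.
  exact: plane_kervec.
split=> //.
  apply: kervec_plane => //; by apply: memv_span; rewrite inE eqxx.
by apply: kervec_plane => //; apply: memv_span; rewrite !inE eqxx orbT.
Qed.

Lemma line_of_planes (t : K) V : ker1 != 0 ->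
  (forall u v, u \in D -> v \in D -> be2 u v = t * be1 u v) ->
  [/\ (V <= D)%VS, \dim V = 2%N, (forall u v, u \in V -> v \in V -> be1 u v = 0) &
      (forall u v, u \in V -> v \in V -> be2 u v = 0)] <->
  [/\ (V <= D)%VS, \dim V = 2%N & ker1 \in V].
Proof.
move=> k10 E; split=> [[VD dV b1 b2]|[VD dV kV]].
  by split => //; exact: plane_kervec.
have b1 := kervec_plane alt1 k10 VD dV kV.
split=> // u v uV vV; rewrite E ?b1 ?mulr0//; exact: (subvP VD).
Qed.

End TwoForms.

(** * Integral planes, and the rank of the pair of forms read off a coframe *)

Section Planes.
Context {R : realType}.
Local Notation E := 'rV[R]_8.
Variables F G : E -> R.
Hypotheses (sF : smooth_on setT F) (sG : smooth_on setT G).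
Implicit Types (u v w x : E) (V : {vspace E}).

Local Notation f := (grad F).
Local Notation g := (grad G).
Local Notation e1 w := (X1 (f w) (g w) w).
Local Notation e2 w := (X2 (f w) (g w) w).
Local Notation e3 w := (vY (f w) (g w)).
Local Notation D w := <<[:: e1 w; e2 w; e3 w]>>%VS.

Lemma symbol_regpts w : row_free (symbol_rows F G w) -> regpts F G w.
Proof.
move=> rf; apply/negP => /eqP n0.
have H p q : (forall i, i \in [:: ir; is_; it] -> p * f w 0 i + q * g w 0 i = 0) ->
    p = 0 /\ q = 0.
  move=> pq; pose c : 'rV[R]_2 := \row_j (if j == 0 then p else q).
  have /eqP : c *m symbol_rows F G w = 0.
    apply/rowP => j; rewrite !mxE !big_ord_recl big_ord0 addr0 !mxE /=.
    have := pq (nth ir [:: ir; is_; it] j); rewrite !mxE; apply.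
    by apply: mem_nth; exact: ltn_ord.
  rewrite mulmx_free_eq0// => /eqP/rowP c0.
  by split; [have := c0 0|have := c0 1]; rewrite !mxE.
have [r0 s0 t0] : [/\ nr (f w) (g w) = 0, ns (f w) (g w) = 0 & nt (f w) (g w) = 0].
  move/eqP: n0; rewrite /nn !paddr_eq0 ?addr_ge0 ?sqr_ge0// !sqrf_eq0.
  by move=> /andP[/andP[/eqP-> /eqP->] /eqP->].
(* By [cross_eq0] the symbol rows have the relation with coefficients (g_i, -f_i), so f_i = 0 for
   every i. Then the relation with coefficients (1, 0) gives the contradiction. *)
have K i : i \in [:: ir; is_; it] -> f w 0 i = 0.
  move=> ij; have [] := H (g w 0 i) (- f w 0 i); last by move=> _ /eqP; rewrite oppr_eq0 => /eqP.
  by move=> j; exact: cross_eq0.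
have [i /K fi0|/eqP] := H 1 0; first by rewrite fi0 mulr0 mul0r addr0.
by rewrite oner_eq0.
Qed.

Section AtPoint.
Variable w : E.
Hypothesis rw : regpts F G w.

Lemma frame_free : free [:: e1 w; e2 w; e3 w].
Proof.
apply/freeP => k; rewrite !big_ord_recl big_ord0 /= addr0 addrA.
move=> /(frame_inj rw)[k0 k1 k2].
move=> [[|[|[|m]]] h] //; rewrite (bool_irrelevance h isT).
- by rewrite -[RHS]k0; congr k; exact: val_inj.
- by rewrite -[RHS]k1; congr k; exact: val_inj.
- by rewrite -[RHS]k2; congr k; exact: val_inj.
Qed.

Lemma Dspace_mem v : Dspace (f w) (g w) w v <-> v \in D w.
Proof.
split=> [vD|/mem_frame[a [b [c ->]]]]; last exact: Dspace_comb.
by have [y ->] := Dspace_span rw vD; apply/mem_frame; do 3!eexists.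
Qed.

Lemma Dsys_mem v : Dsys F G w v <-> v \in D w.
Proof. by split=> [/(DsysP sF sG)/Dspace_mem//|/Dspace_mem/(DsysP sF sG)]. Qed.

Lemma altform_varpi1 : altform (extd (@varpi1 R) w).
Proof.
by split=> *; rewrite !extd_varpi1 ?mxE; ring.
Qed.

Lemma altform_varpi2 : altform (extd (@varpi2 R) w).
Proof.
by split=> *; rewrite !extd_varpi2 ?mxE; ring.
Qed.

Local Notation be1 := (extd (@varpi1 R) w).
Local Notation be2 := (extd (@varpi2 R) w).

(** By [extd_varpi0_D] the form d varpi0 is already zero on D, which leaves two conditions. *)
Lemma SigmaP V : locus F G w -> Sigma F G (w, V) <->
  [/\ (V <= D w)%VS, \dim V = 2%N, (forall u v, u \in V -> v \in V -> be1 u v = 0) &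
      (forall u v, u \in V -> v \in V -> be2 u v = 0)].
Proof.
move=> lw; split=> [[_ [/= dV VD V0]]|[VD dV b1 b2]].
  split=> //; [|exact: (V0 1%N)|exact: (V0 2%N)].
  by apply/subvP => v vV; apply/Dsys_mem; exact: VD.
split; [exact: lw|split; [exact: dV|move=> v vV|]].
  by apply/Dsys_mem; exact: (subvP VD _ vV).
case=> [|[|[|//]]] _ u v uV vV; [|exact: (b1 _ _ uV vV)|exact: (b2 _ _ uV vV)].
have uD := (Dspace_mem u).2 (subvP VD _ uV); have vD := (Dspace_mem v).2 (subvP VD _ vV).
exact: (extd_varpi0_D uD vD).
Qed.

(** The vector [vY] has no x or y component, so pairing it with [X1] and [X2] picks out its r, s, t
    components. This and [frame_varpi2] are how the minors enter the rank discussion. *)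
Lemma frame_varpi1 : be1 (e2 w) (e3 w) = ns (f w) (g w) /\
  be1 (e1 w) (e3 w) = nr (f w) (g w).
Proof.
have [h1 h2] := X1_xy (f w) (g w) w; have [h3 h4] := X2_xy (f w) (g w) w.
have [h5 h6 h7 h8 h9] := vY_coord (f w) (g w).
by rewrite !extd_varpi1 h1 h2 h3 h4 h5 h6 h7 h8; split; ring.
Qed.

Lemma frame_varpi2 : be2 (e2 w) (e3 w) = nt (f w) (g w) /\
  be2 (e1 w) (e3 w) = ns (f w) (g w).
Proof.
have [h1 h2] := X1_xy (f w) (g w) w; have [h3 h4] := X2_xy (f w) (g w) w.
have [h5 h6 h7 h8 h9] := vY_coord (f w) (g w).
by rewrite !extd_varpi2 h1 h2 h3 h4 h5 h6 h8 h9; split; ring.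
Qed.

Definition rank_two : Prop := forms_indep be1 be2 (e1 w) (e2 w) (e3 w).

Definition rank_one : Prop := exists l m : R, (l, m) != (0, 0) /\
  forall u v, u \in D w -> v \in D w -> l * be1 u v + m * be2 u v = 0.

Section Coframe.
Variables (U : set E) (a1 a2 o1 o2 p : @form1 R).
Hypotheses (lw : locus F G w) (Uw : open_nbhs w U).
Hypotheses (sa1 : smooth_on U a1) (sa2 : smooth_on U a2).
Hypothesis cof : dual_basis (tangent F G w)
  [:: varpi0 w; a1 w; a2 w; o1 w; o2 w; p w].
Hypothesis DE : forall x, locus F G x -> U x ->
  Dsys F G x = pfaff (tangent F G) [:: varpi0; a1; a2] x.

Lemma coframe_D v : v \in D w ->
  [/\ ev (varpi0 w) v = 0, ev (a1 w) v = 0 & ev (a2 w) v = 0].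
Proof.
move=> /Dsys_mem; rewrite DE//; last by case: Uw.
by move=> [_ H]; split; [exact: (H 0%N)|exact: (H 1%N)|exact: (H 2%N)].
Qed.

Lemma coframe_comb a : a = a1 \/ a = a2 -> exists c0 c1 c2 : R,
    (forall v, tangent F G w v -> ev (a w) v =
       c0 * ev (varpi0 w) v + c1 * ev (varpi1 w) v + c2 * ev (varpi2 w) v) /\
    (forall u v, u \in D w -> v \in D w ->
       extd a w u v = c1 * be1 u v + c2 * be2 u v).
Proof.
move=> aE; have [oU wU] := Uw.
have da : differentiable a w by case: aE => ->; [exact: smooth_on_diff sa1 wU|
  exact: smooth_on_diff sa2 wU].
have [|c0 [c1 [c2 [H1 H2]]]] := extd_annihilator sF sG lw rw da.
  apply: filterS (open_nbhs_nbhs Uw) => x Ux lx v; rewrite DE// => -[_ H].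
  by case: aE => ->; [exact: (H 1%N)|exact: (H 2%N)].
exists c0, c1, c2; split=> // u v /Dsys_mem uD /Dsys_mem vD; exact: H2.
Qed.

Lemma eqmod2_D (S : E -> E -> R) a u v :
  eqmod2 (tangent F G w) [:: varpi0 w; a1 w; a2 w] (extd a w) S ->
  u \in D w -> v \in D w -> extd a w u v = S u v.
Proof.
move=> [eta H] uD vD; have [u0 u1 u2] := coframe_D uD; have [v0 v1 v2] := coframe_D vD.
have /Dsys_mem[tu _] := uD; have /Dsys_mem[tv _] := vD.
apply/eqP; rewrite -subr_eq0 H// !big_ord_recl big_ord0 /wedge /= u0 u1 u2 v0 v1 v2.
by rewrite !mulr0 subrr !addr0.
Qed.

(** On D the first three forms of the coframe vanish, so the other three separate its vectors; their
    matrix [M] in the frame is invertible, and its inverse gives the dual basis. *)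
Lemma coframe_dual : exists z1 z2 z3, [/\ z1 \in D w, z2 \in D w & z3 \in D w] /\
  [/\ [/\ ev (o1 w) z1 = 1, ev (o1 w) z2 = 0 & ev (o1 w) z3 = 0],
      [/\ ev (o2 w) z1 = 0, ev (o2 w) z2 = 1 & ev (o2 w) z3 = 0] &
      [/\ ev (p w) z1 = 0, ev (p w) z2 = 0 & ev (p w) z3 = 1]].
Proof.
pose e (i : 'I_3) := nth 0 [:: e1 w; e2 w; e3 w] i.
pose o (j : 'I_3) := nth 0 [:: o1 w; o2 w; p w] j.
have cE (c : 'rV[R]_3) : \sum_i c 0 i *: e i = lincomb (e1 w) (e2 w) (e3 w)
    (c 0 0) (c 0 1) (c 0 2%:R).
  rewrite !big_ord_recl big_ord0 addr0 addrA /lincomb /e /=.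
  by congr (_ *: _ + _ *: _ + _ *: _); congr (c _ _); exact: val_inj.
have cD (c : 'rV[R]_3) : \sum_i c 0 i *: e i \in D w.
  by rewrite cE; apply/mem_frame; do 3!eexists.
pose M : 'M[R]_3 := \matrix_(i, j) ev (o j) (e i).
have evs a (c : 'rV[R]_3) : ev a (\sum_i c 0 i *: e i) = \sum_i c 0 i * ev a (e i).
  rewrite (big_morph (ev a) (evDr a) (_ : ev a 0 = 0)); last first.
    by rewrite -(scale0r a) evZr mul0r.
  by apply: eq_bigr => i _; rewrite evZr.
have Mu : M \in unitmx.
  rewrite -row_free_unit; apply/inj_row_free => c /rowP cM.
  pose v := \sum_i c 0 i *: e i.
  have ov j : ev (o j) v = 0.
    have := cM j; rewrite !mxE evs => h; rewrite -[RHS]h.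
    by apply: eq_bigr => i _; rewrite mxE.
  have v0 : v = 0.
    (* The covector with the coefficients of [v] is a combination of the coframe on the tangent
       space. All six forms vanish at [v], so its sum of squares is 0. *)
    have [c' [H _]] := cof v.
    have vv : ev v v = 0.
      have [h0 h1 h2] := coframe_D (cD c).
      have [tv _] : Dsys F G w v by apply/Dsys_mem; exact: cD.
      rewrite H// !big_ord_recl big_ord0 /= h0 h1 h2.
      have := ov 0; have := ov 1; have := ov 2%:R; rewrite /o /= => -> -> ->.
      by rewrite !mulr0 !addr0.
    apply/rowP => i; rewrite mxE; move/eqP: vv; rewrite /ev.
    rewrite psumr_eq0 => [|j _]; last by rewrite -expr2 sqr_ge0.
    by move=> /allP /(_ i (mem_index_enum _)) /=; rewrite -expr2 sqrf_eq0 => /eqP.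
  have := v0; rewrite /v cE => /(frame_comb0 frame_free)[c0 c1 c2].
  apply/rowP => -[[|[|[|m]]] h] //; rewrite mxE (bool_irrelevance h isT).
  - by rewrite -[RHS]c0; congr (c _ _); exact: val_inj.
  - by rewrite -[RHS]c1; congr (c _ _); exact: val_inj.
  - by rewrite -[RHS]c2; congr (c _ _); exact: val_inj.
pose z (j : 'I_3) := \sum_i row j (invmx M) 0 i *: e i.
have zo j l : ev (o l) (z j) = (j == l)%:R.
  rewrite evs; have := mulVmx Mu => /matrixP/(_ j l); rewrite !mxE => <-.
  by apply: eq_bigr => i _; rewrite !mxE.
exists (z 0), (z 1), (z 2%:R); split; first by split; exact: cD.
by split; split; [exact: (zo 0 0)|exact: (zo 1 0)|exact: (zo 2%:R 0)|
  exact: (zo 0 1)|exact: (zo 1 1)|exact: (zo 2%:R 1)|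
  exact: (zo 0 2%:R)|exact: (zo 1 2%:R)|exact: (zo 2%:R 2%:R)].
Qed.

(** The equation for d [a1] is itself the relation between the two forms. Were its coefficients both
    zero, [a1] would be a multiple of varpi0 on the tangent space, giving it the two distinct
    coordinate vectors [d1] and [d2] in the coframe. *)
Lemma coframe_rank_one :
  eqmod2 (tangent F G w) [:: varpi0 w; a1 w; a2 w] (extd a1 w) (fun _ _ => 0) ->
  rank_one.
Proof.
move=> S1; have [c0 [c1 [c2 [H1 H2]]]] := coframe_comb (or_introl erefl).
exists c1, c2; split; last by move=> u v uD vD; rewrite -H2// (eqmod2_D S1).
apply/eqP => -[c10 c20].
have [c' [_ uniq]] := cof (a1 w).
pose d1 : 'rV[R]_6 := delta_mx 0 1; pose d2 : 'rV[R]_6 := c0 *: delta_mx 0 0.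
have E1 : c' = d1.
  by apply: uniq => v tv; rewrite !big_ord_recl big_ord0 !mxE /=; ring.
have E2 : c' = d2.
  apply: uniq => v tv; rewrite H1// c10 c20 !big_ord_recl big_ord0 !mxE /=; ring.
have : d1 0 1 = d2 0 1 by rewrite -E1 -E2.
by rewrite !mxE /= mulr0 => /eqP; rewrite oner_eq0.
Qed.

(** Given l b1 + m b2 = 0, put q1 = c1 m - c2 l and q2 = d1 m - d2 l. Then q2 S1 - q1 S2 = 0, so q1
    = q2 = 0 by independence. Now m S1 = q1 b1 and l S1 = - q1 b2 vanish, and independence applied
    again gives l = m = 0. *)
Lemma coframe_rank_two (S1 S2 : E -> E -> R) :
  eqmod2 (tangent F G w) [:: varpi0 w; a1 w; a2 w] (extd a1 w) S1 ->
  eqmod2 (tangent F G w) [:: varpi0 w; a1 w; a2 w] (extd a2 w) S2 ->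
  (forall l m : R, (forall u v, u \in D w -> v \in D w -> l * S1 u v + m * S2 u v = 0) ->
    l = 0 /\ m = 0) -> rank_two.
Proof.
move=> E1 E2 ind l m lm.
have [c0 [c1 [c2 [_ H1]]]] := coframe_comb (or_introl erefl).
have [d0 [d1 [d2 [_ H2]]]] := coframe_comb (or_intror erefl).
have K (b1 b2 s1 s2 : R) : l * b1 + m * b2 = 0 -> s1 = c1 * b1 + c2 * b2 ->
    s2 = d1 * b1 + d2 * b2 -> [/\
    m * s1 = (c1 * m - c2 * l) * b1, l * s1 = - (c1 * m - c2 * l) * b2 &
    (d1 * m - d2 * l) * s1 + - (c1 * m - c2 * l) * s2 = 0].
  move=> e -> ->; split.
  - apply/eqP; rewrite -subr_eq0 -[X in _ == X](mulr0 c2) -e; apply/eqP; ring.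
  - apply/eqP; rewrite -subr_eq0 -[X in _ == X](mulr0 c1) -e; apply/eqP; ring.
  - rewrite -(mulr0 (c2 * d1 - c1 * d2)) -e; ring.
have HS u v : u \in D w -> v \in D w -> [/\
    m * S1 u v = (c1 * m - c2 * l) * be1 u v, l * S1 u v = - (c1 * m - c2 * l) * be2 u v &
    (d1 * m - d2 * l) * S1 u v + - (c1 * m - c2 * l) * S2 u v = 0].
  move=> uD vD; apply: K; first exact: lm.
    by rewrite -(eqmod2_D E1)// H1.
  by rewrite -(eqmod2_D E2)// H2.
have [q2 /eqP] : d1 * m - d2 * l = 0 /\ - (c1 * m - c2 * l) = 0.
  by apply: ind => u v uD vD; have [] := HS u v uD vD.
rewrite oppr_eq0 => /eqP q1.
split; [have [] := ind l 0|have [] := ind m 0] => // u v uD vD.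
  by have [_ -> _] := HS u v uD vD; rewrite q1 oppr0 !mul0r addr0.
by have [-> _ _] := HS u v uD vD; rewrite q1 !mul0r addr0.
Qed.

End Coframe.
End AtPoint.

Lemma type_rank_one w : locus F G w -> regpts F G w -> of_type F G TypeI -> rank_one w.
Proof.
move=> lw rw /(_ w lw)[U [a1 [a2 [ o1 [ o2 [p [Uw [sa1 sa2 _ _ _] cof DE [_ S1 _]]]]]]]].
have wU : U w by case: Uw.
exact: (coframe_rank_one rw lw Uw sa1 sa2 (cof w lw wU) DE S1).
Qed.

(** Outside type (I) the two right-hand sides are distinct members of the basis o1 /\ o2, o1 /\ p,
    o2 /\ p of 2-forms on D. *)
Lemma type_rank_two w k : locus F G w -> regpts F G w -> of_type F G k ->
  k <> TypeI -> rank_two w.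
Proof.
move=> lw rw /(_ w lw)[U [a1 [a2 [ o1 [ o2 [p [Uw [sa1 sa2 _ _ _] cof DE [_ S1 S2]]]]]]]].
have wU : U w by case: Uw.
move=> kI; apply: (coframe_rank_two rw lw Uw sa1 sa2 DE S1 S2) => l m H.
have [z1 [z2 [z3 [[m1 m2 m3] zz]]]] := coframe_dual rw lw Uw (cof w lw wU) DE.
move: zz => [[x1 x2 x3] [y1 y2 y3] [t1 t2 t3]].
(* Evaluation on pairs of dual vectors reads off the coefficients of the three basic 2-forms. *)
have := H z1 z2 m1 m2; have := H z1 z3 m1 m3; have := H z2 z3 m2 m3.
case: k kI {S1 S2 H} => // _; rewrite /structure_eq1 /structure_eq2 /wedge;
  rewrite x1 x2 x3 y1 y2 y3 t1 t2 t3 => h1 h2 h3; split; lra.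
Qed.

End Planes.

(** * The circle of planes through a line *)

Section OrthogonalProjections.
Context {R : realType}.
Local Notation E := 'rV[R]_8.
Implicit Types (a b k m u v : E) (V : {vspace E}).

Lemma ev_gt0 v : v != 0 -> 0 < ev v v.
Proof.
move=> v0; have vv : 0 <= ev v v by apply: sumr_ge0 => i _; rewrite -expr2 sqr_ge0.
rewrite lt_neqAle vv andbT eq_sym; apply: contra v0 => /eqP vv0.
apply/eqP/rowP => i; rewrite mxE; move/eqP: vv0; rewrite /ev.
rewrite psumr_eq0 => [|j _]; last by rewrite -expr2 sqr_ge0.
by move=> /allP /(_ i (mem_index_enum _)) /=; rewrite -expr2 sqrf_eq0 => /eqP.
Qed.

Definition outer a b : 'M[R]_8 := \matrix_(i, j) (a 0 i * b 0 j).

Lemma mul_outer v a b : v *m outer a b = ev v a *: b.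
Proof.
apply/rowP => j; rewrite !mxE /ev mulr_suml.
by apply: eq_bigr => i _; rewrite !mxE mulrA.
Qed.

Lemma tr_outer a b : (outer a b)^T = outer b a.
Proof. by apply/matrixP => i j; rewrite !mxE mulrC. Qed.

Definition proj2 k m : 'M[R]_8 :=
  (ev k k)^-1 *: outer k k + (ev m m)^-1 *: outer m m.

Lemma mul_proj2 v k m :
  v *m proj2 k m = (ev v k / ev k k) *: k + (ev v m / ev m m) *: m.
Proof.
by rewrite mulmxDr -!scalemxAr !mul_outer !scalerA !(mulrC (_ ^-1)).
Qed.

(** This frees the projection P from the chosen basis of V: Q P = P because Q is symmetric and fixes
    V, and Q P = Q because the rows of Q lie in V. *)
Lemma orthproj_fix V (Q : 'M[R]_8) : Q^T = Q -> (forall v, v *m Q \in V) ->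
  (forall v, v \in V -> v *m Q = v) -> orthproj V = Q.
Proof.
move=> Qs QV VQ; rewrite /orthproj.
set B : 'M[R]_(\dim V, 8) := \matrix_(i < \dim V) (vbasis V)`_i.
have Bc (c : 'rV_(\dim V)) : c *m B = \sum_i c 0 i *: (vbasis V)`_i.
  by rewrite mulmx_sum_row; apply: eq_bigr => i _; rewrite rowK.
have Binj (c : 'rV_(\dim V)) : c *m B = 0 -> c = 0.
  rewrite Bc => c0; have /freeP := basis_free (vbasisP V).
  by move=> /(_ (c 0) c0) H; apply/rowP => i; rewrite H mxE.
(* The Gram matrix is invertible: if c annihilates it, then c B has norm zero. *)
have BBu : B *m B^T \in unitmx.
  rewrite -row_free_unit; apply/inj_row_free => c cBB; apply: Binj.
  apply/eqP; apply: contraT => /ev_gt0; rewrite (_ : ev _ _ = 0) ?ltxx//.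
  have : (c *m B *m (c *m B)^T) 0 0 = 0.
    by rewrite trmx_mul mulmxA -(mulmxA c) cBB mul0mx mxE.
  move: (c *m B) => y; rewrite mxE => h; rewrite -[RHS]h.
  by apply: eq_bigr => i _; congr (_ * _); rewrite mxE.
have BQ : B *m Q = B.
  apply/row_matrixP => i; rewrite row_mul rowK VQ//.
  by apply: vbasis_mem; apply: mem_nth; rewrite size_tuple.
have QB : Q *m B^T = B^T by rewrite -[in LHS]Qs -trmx_mul BQ.
pose X : 'M[R]_(8, \dim V) := \matrix_(i, j) coord (vbasis V) j (row i Q).
have QX : Q = X *m B.
  apply/row_matrixP => i; rewrite row_mul Bc.
  have rV : row i Q \in V by rewrite rowE.
  rewrite [LHS](coord_vbasis rV). apply: eq_bigr => j _.
  by congr (_ *: _); rewrite !mxE.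
transitivity (Q *m (B^T *m invmx (B *m B^T) *m B)); first by rewrite !mulmxA QB.
rewrite [in LHS]QX [RHS]QX -!mulmxA; congr (X *m _).
by rewrite !mulmxA mulmxV// mul1mx.
Qed.

Lemma orthproj_proj2 k m : k != 0 -> m != 0 -> ev k m = 0 ->
  orthproj <<[:: k; m]>>%VS = proj2 k m.
Proof.
move=> /ev_gt0/lt0r_neq0 k0 /ev_gt0/lt0r_neq0 m0 km.
have mk : ev m k = 0 by rewrite evC.
have inV (a b : R) : a *: k + b *: m \in <<[:: k; m]>>%VS.
  by rewrite memvD// memvZ// memv_span// !inE eqxx ?orbT.
apply: orthproj_fix => [|v|v].
- by rewrite raddfD /= !linearZ /= !tr_outer.
- by rewrite mul_proj2.
rewrite !span_cons span_nil addv0 => /memv_addP[_ /vlineP[a ->] [_ /vlineP[b ->] ->]].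
rewrite mul_proj2 !evDl !evZl km mk !mulr0 addr0 add0r !mulfK//.
Qed.

End OrthogonalProjections.

Section HalfAngle.
Context {R : realFieldType}.

(** The tangent of the half angle is s / (1 + c), which suggests (al, be) = (1 + c, s). At c = -1
    this pair is zero and (0, 1) replaces it. *)
Lemma half_angle (c s : R) : c ^+ 2 + s ^+ 2 = 1 -> exists al be : R,
  [/\ al ^+ 2 + be ^+ 2 != 0, c * (al ^+ 2 + be ^+ 2) = al ^+ 2 - be ^+ 2 &
      s * (al ^+ 2 + be ^+ 2) = 2 * al * be].
Proof.
move=> cs; have [c1|c1] := eqVneq c (-1).
  have s0 : s = 0.
    by apply/eqP; rewrite -sqrf_eq0; apply/eqP; move: cs; rewrite c1 sqrrN expr1n; lra.
  exists 0, 1; rewrite s0 c1; split; [|ring|ring].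
  by rewrite expr0n /= add0r expr1n oner_neq0.
have E : (1 + c) ^+ 2 + s ^+ 2 = 2 * (1 + c) by lra.
exists (1 + c), s; split.
- rewrite E mulf_neq0 ?pnatr_eq0//; apply: contra c1 => /eqP h.
  by apply/eqP; lra.
- have sE : s ^+ 2 = 1 - c ^+ 2 by rewrite -cs; ring.
  by rewrite sE; ring.
- by rewrite E; ring.
Qed.

End HalfAngle.

Lemma open_neq0_on (R : realType) (V : normedModType R) (W : set V) (h : V -> R) :
  open W -> (forall x, W x -> differentiable h x) -> open (W `&` [set x | h x != 0]).
Proof.
move=> oW dh; rewrite openE => x [Wx hx]; apply: filterI.
  exact: (open_nbhs_nbhs (conj oW Wx)).
have ch := differentiable_continuous (dh x Wx).
apply: (ch [set y | y != 0]).
by apply: open_nbhs_nbhs; split; [exact: open_neq|].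
Qed.

Lemma circle_double_angle (R : realType) (u : 'rV[R]_2) (al be : R) :
  al ^+ 2 + be ^+ 2 != 0 -> u 0 0 * (al ^+ 2 + be ^+ 2) = al ^+ 2 - be ^+ 2 ->
  u 0 1 * (al ^+ 2 + be ^+ 2) = 2 * al * be -> circle u.
Proof.
move=> r0 cE sE; have r2 : (al ^+ 2 + be ^+ 2) ^+ 2 != 0 by rewrite expf_neq0.
by apply: (mulIf r2); rewrite mulrDl -!exprMn cE sE; ring.
Qed.

Section CircleChart.
Context {R : realType}.
Local Notation E := 'rV[R]_8.
Variables (Sg : set (E * {vspace E})) (B U : set E) (k e f : E -> E).
Hypothesis oU : open U.
Hypotheses (sk : smooth_on U k) (se : smooth_on U e) (sf : smooth_on U f).
Hypotheses (k0 : forall x, U x -> k x != 0) (e0 : forall x, U x -> e x != 0)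
  (f0 : forall x, U x -> f x != 0).
Hypotheses (ke : forall x, U x -> ev (k x) (e x) = 0)
  (kf : forall x, U x -> ev (k x) (f x) = 0) (ef : forall x, U x -> ev (e x) (f x) = 0).
Hypothesis SgB : forall x V, Sg (x, V) -> B x.
Hypothesis SgP : forall x V, B x -> U x -> Sg (x, V) <->
  [/\ (V <= <<[:: k x; e x; f x]>>)%VS, \dim V = 2%N & k x \in V].
Implicit Types (x : E) (u : 'rV[R]_2) (al be : R).

(** For (c, s) the double angle of (al, be), the numbers (1 + c) / 2, (1 - c) / 2 and s / 2 are
    al^2, be^2 and al be divided by al^2 + be^2. The projection is thus written in c and s without
    choosing al and be; this denominator is |al e + be f|^2 / (al^2 + be^2). *)
Definition chart_den (z : E * 'rV[R]_2) : R :=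
  (1 + z.2 0 0) / 2 * ev (e z.1) (e z.1) + (1 - z.2 0 0) / 2 * ev (f z.1) (f z.1).

Definition chart_plane (z : E * 'rV[R]_2) : 'M[R]_8 :=
  (ev (k z.1) (k z.1))^-1 *: outer (k z.1) (k z.1) +
  (chart_den z)^-1 *: ((1 + z.2 0 0) / 2 *: outer (e z.1) (e z.1) +
    z.2 0 1 / 2 *: (outer (e z.1) (f z.1) + outer (f z.1) (e z.1)) +
    (1 - z.2 0 0) / 2 *: outer (f z.1) (f z.1)).

Definition chart (z : E * 'rV[R]_2) : E * 'M[R]_8 := (z.1, chart_plane z).

(** Entries of the projection in the frame (e, f), divided by norms because the frame is only
    orthogonal. For the plane through k and m = al e + be f, [Nee], [Nff] and [Nef] are al^2, be^2
    and al be over |m|^2 (see [N_dir]), so their ratios give the double angle. *)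
Definition Nee (y : E * 'M[R]_8) : R :=
  ev (e y.1 *m y.2) (e y.1) / (ev (e y.1) (e y.1) * ev (e y.1) (e y.1)).
Definition Nff (y : E * 'M[R]_8) : R :=
  ev (f y.1 *m y.2) (f y.1) / (ev (f y.1) (f y.1) * ev (f y.1) (f y.1)).
Definition Nef (y : E * 'M[R]_8) : R :=
  ev (e y.1 *m y.2) (f y.1) / (ev (e y.1) (e y.1) * ev (f y.1) (f y.1)).

Definition chart_inv (y : E * 'M[R]_8) : E * 'rV[R]_2 :=
  (y.1, ((Nee y - Nff y) / (Nee y + Nff y)) *: delta_mx 0 0 +
        (2 * Nef y / (Nee y + Nff y)) *: delta_mx 0 1).

Local Notation dir x al be := (al *: e x + be *: f x).

Lemma dir_norm x al be : U x -> ev (al *: e x + be *: f x) (al *: e x + be *: f x) =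
  al ^+ 2 * ev (e x) (e x) + be ^+ 2 * ev (f x) (f x).
Proof.
by move=> Ux; rewrite !evDl !evDr !evZl !evZr (evC (f x) (e x)) ef//; ring.
Qed.

Lemma dir_orth x al be : U x -> ev (k x) (al *: e x + be *: f x) = 0.
Proof. by move=> Ux; rewrite evDr !evZr ke// kf// !mulr0 addr0. Qed.

Lemma dir_neq0 x al be : U x -> al ^+ 2 + be ^+ 2 != 0 -> al *: e x + be *: f x != 0.
Proof.
move=> Ux r0; apply: contra r0 => /eqP m0.
have ee := ev_gt0 (e0 Ux); have ff := ev_gt0 (f0 Ux).
have := dir_norm al be Ux; rewrite m0 -{1}(scale0r 0) evZl mul0r => /esym/eqP.
have [ee' ff'] := (ltW ee, ltW ff).
rewrite paddr_eq0; [|exact: mulr_ge0 (sqr_ge0 _) ee'|exact: mulr_ge0 (sqr_ge0 _) ff'].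
rewrite !mulf_eq0 (gt_eqF ee) (gt_eqF ff) !orbF !orbb => /andP[/eqP-> /eqP->].
by rewrite expr0n addr0.
Qed.

Lemma orthproj_dir x al be : U x -> al ^+ 2 + be ^+ 2 != 0 ->
  orthproj <<[:: k x; dir x al be]>>%VS = proj2 (k x) (al *: e x + be *: f x).
Proof.
move=> Ux r0; apply: orthproj_proj2; [exact: k0|exact: dir_neq0|exact: dir_orth].
Qed.

Lemma chartE x u al be : U x -> al ^+ 2 + be ^+ 2 != 0 ->
  u 0 0 * (al ^+ 2 + be ^+ 2) = al ^+ 2 - be ^+ 2 ->
  u 0 1 * (al ^+ 2 + be ^+ 2) = 2 * al * be ->
  chart_den (x, u) != 0 /\
  chart (x, u) = (x, orthproj <<[:: k x; dir x al be]>>%VS).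
Proof.
move=> Ux r0 cE sE; have mm := lt0r_neq0 (ev_gt0 (dir_neq0 Ux r0)).
have c1 : (1 + u 0 0) / 2 = al ^+ 2 / (al ^+ 2 + be ^+ 2).
  apply: (mulIf r0); rewrite divfK//.
  have -> : (1 + u 0 0) / 2 * (al ^+ 2 + be ^+ 2) =
    ((al ^+ 2 + be ^+ 2) + u 0 0 * (al ^+ 2 + be ^+ 2)) / 2 by field.
  by rewrite cE; field.
have c2 : (1 - u 0 0) / 2 = be ^+ 2 / (al ^+ 2 + be ^+ 2).
  apply: (mulIf r0); rewrite divfK//.
  have -> : (1 - u 0 0) / 2 * (al ^+ 2 + be ^+ 2) =
    ((al ^+ 2 + be ^+ 2) - u 0 0 * (al ^+ 2 + be ^+ 2)) / 2 by field.
  by rewrite cE; field.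
have s1 : u 0 1 / 2 = al * be / (al ^+ 2 + be ^+ 2).
  apply: (mulIf r0); rewrite divfK// mulrAC sE.
  by field.
have denE : chart_den (x, u) =
    ev (al *: e x + be *: f x) (al *: e x + be *: f x) / (al ^+ 2 + be ^+ 2).
  by rewrite dir_norm// /chart_den /= c1 c2; field.
have D0 : chart_den (x, u) != 0.
  by rewrite denE; apply: mulf_neq0; [exact: mm|rewrite invr_eq0].
split; [exact: D0|].
congr pair; rewrite orthproj_dir// /proj2 /chart_plane denE /= c1 c2 s1.
congr (_ + _); move: (ev (al *: e x + _) _) mm => M M0.
apply/matrixP => i j; rewrite !mxE; field.
by rewrite M0 r0.
Qed.

Lemma N_dir x al be : U x -> al ^+ 2 + be ^+ 2 != 0 ->
  let m := al *: e x + be *: f x in let y := (x, proj2 (k x) m) in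
  [/\ Nee y = al ^+ 2 / ev m m, Nff y = be ^+ 2 / ev m m & Nef y = al * be / ev m m].
Proof.
move=> Ux r0 m y; have mm := lt0r_neq0 (ev_gt0 (dir_neq0 Ux r0)).
have ee := lt0r_neq0 (ev_gt0 (e0 Ux)); have ff := lt0r_neq0 (ev_gt0 (f0 Ux)).
have ek : ev (e x) (k x) = 0 by rewrite evC ke.
have fk : ev (f x) (k x) = 0 by rewrite evC kf.
have me : ev m (e x) = al * ev (e x) (e x).
  by rewrite /m evDl !evZl (evC (f x)) ef// mulr0 addr0.
have mf : ev m (f x) = be * ev (f x) (f x).
  by rewrite /m evDl !evZl ef// mulr0 add0r.
rewrite /Nee /Nff /Nef /y /= !mul_proj2 ek fk !mul0r !scale0r !add0r !evZl.
rewrite (evC (e x) m) (evC (f x) m) me mf.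
by move: (ev m m) (ev (e x) (e x)) (ev (f x) (f x)) mm ee ff => M p q M0 p0 q0;
  split; field; rewrite ?M0 ?p0 ?q0.
Qed.

Lemma chart_invE x al be : U x -> al ^+ 2 + be ^+ 2 != 0 ->
  let y := (x, orthproj <<[:: k x; dir x al be]>>%VS) in
  let u := (chart_inv y).2 in
  [/\ Nee y + Nff y != 0, u 0 0 * (al ^+ 2 + be ^+ 2) = al ^+ 2 - be ^+ 2 &
      u 0 1 * (al ^+ 2 + be ^+ 2) = 2 * al * be].
Proof.
move=> Ux r0 y u; have mm := lt0r_neq0 (ev_gt0 (dir_neq0 Ux r0)).
have [h1 h2 h3] := N_dir Ux r0.
rewrite /u /chart_inv /y orthproj_dir// !mxE /= h1 h2 h3.
move: (ev _ _) mm => M M0.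
split; first by rewrite -mulrDl mulf_neq0 ?invr_eq0.
- by field; rewrite ?M0 ?r0.
- by field; rewrite ?M0 ?r0.
Qed.

Lemma plane_dir x V : U x -> (V <= <<[:: k x; e x; f x]>>)%VS -> \dim V = 2%N ->
  k x \in V -> exists al be, al ^+ 2 + be ^+ 2 != 0 /\
    V = <<[:: k x; dir x al be]>>%VS.
Proof.
move=> Ux VD dV kV.
have /subvPn[m mV mk] : ~~ (V <= <[k x]>)%VS.
  by apply/negP => /dimvS; rewrite dV dim_vline; case: (k x == 0).
have := subvP VD _ mV; rewrite !span_cons span_nil addv0.
move=> /memv_addP[_ /vlineP[a ->] [_ /memv_addP[_ /vlineP[al ->] [_ /vlineP[be ->] ->]] mE]].
exists al, be.
have r0 : al ^+ 2 + be ^+ 2 != 0.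
  apply: contra mk; rewrite paddr_eq0 ?sqr_ge0// !sqrf_eq0 => /andP[/eqP a0 /eqP b0].
  by rewrite mE a0 b0 !scale0r !addr0; apply/vlineP; exists a.
split=> //.
have nV : al *: e x + be *: f x \in V.
  have -> : al *: e x + be *: f x = m - a *: k x by rewrite mE addrAC subrr add0r.
  by rewrite memvB// memvZ.
apply/eqP; rewrite eq_sym eqEdim dV; apply/andP; split.
  by apply/span_subvP => z; rewrite !inE => /orP[] /eqP->.
have : free [:: k x; dir x al be].
  rewrite free_cons span_seq1 seq1_free dir_neq0// andbT.
  apply/negP => /vlineP[c kE]; have := ev_gt0 (k0 Ux).
  by rewrite {2}kE evZr dir_orth// mulr0 ltxx.
by move=> /eqP /= ->.
Qed.

Lemma dir_plane x al be : B x -> U x -> al ^+ 2 + be ^+ 2 != 0 ->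
  Sg (x, <<[:: k x; dir x al be]>>%VS).
Proof.
move=> Bx Ux r0; apply/SgP => //; split.
- apply/span_subvP => z; rewrite !inE => /orP[] /eqP->.
    by apply: memv_span; rewrite inE eqxx.
  by rewrite memvD// memvZ// memv_span// !inE eqxx !orbT.
- have : free [:: k x; dir x al be].
    rewrite free_cons span_seq1 seq1_free dir_neq0// andbT.
    apply/negP => /vlineP[c kE]; have := ev_gt0 (k0 Ux).
    by rewrite {2}kE evZr dir_orth// mulr0 ltxx.
  by move=> /eqP.
- by apply: memv_span; rewrite inE eqxx.
Qed.

Lemma smooth_outer (V : normedModType R) (W : set V) (a b : V -> E) : open W ->
  smooth_on W a -> smooth_on W b -> smooth_on W (fun z => outer (a z) (b z)).
Proof.
move=> oW sa sb; apply: smooth_on_mx => // i j.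
apply: (smooth_on_eq oW _ (smooth_onM oW (smooth_on_coord 0 i oW sa)
  (smooth_on_coord 0 j oW sb))).
by move=> z _; rewrite mxE.
Qed.

Lemma open_fst (V W : normedModType R) (A : set V) :
  open A -> open (fst @^-1` A : set (V * W)).
Proof. by move=> oA; apply: open_comp => // z _; exact: cvg_fst. Qed.

Lemma smooth_den : smooth_on (fst @^-1` U) chart_den.
Proof.
have oW : open (fst @^-1` U : set (E * 'rV[R]_2)) by exact: open_fst.
have s2 : smooth_on (fst @^-1` U) (fun z : E * 'rV[R]_2 => z.2 0 0).
  apply: (smooth_on_sub (@subsetT _ _)).
  apply: (@smooth_on_snd _ _ _ _ setT (fun u : 'rV[R]_2 => u 0 0)).
  by apply: (@smooth_on_coord _ _ _ _ _ id) => //; [exact: openT|exact: smooth_on_id].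
have se' := @smooth_on_fst _ _ 'rV[R]_2 _ _ _ se.
have sf' := @smooth_on_fst _ _ 'rV[R]_2 _ _ _ sf.
apply: smooth_onD => //; apply: smooth_onM => //; try exact: smooth_on_ev.
  apply: smooth_onM => //; last exact: smooth_on_cst.
  by apply: smooth_onD => //; exact: smooth_on_cst.
apply: smooth_onM => //; last exact: smooth_on_cst.
by apply: smooth_onD => //; [exact: smooth_on_cst|exact: smooth_onN].
Qed.

Lemma open_chart_dom : open (fst @^-1` U `&` [set z | chart_den z != 0]).
Proof.
apply: open_neq0_on => [|z Uz]; first exact: open_fst.
exact: smooth_on_diff smooth_den Uz.
Qed.

Lemma smooth_chart :
  smooth_on (fst @^-1` U `&` [set z | chart_den z != 0]) chart.
Proof.
set W := _ `&` _; have oW : open W by exact: open_chart_dom.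
have WU : W `<=` fst @^-1` U by move=> z [].
have s2 i : smooth_on W (fun z : E * 'rV[R]_2 => z.2 0 i).
  apply: (smooth_on_sub (@subsetT _ _)).
  apply: (@smooth_on_snd _ _ _ _ setT (fun u : 'rV[R]_2 => u 0 i)).
  by apply: (@smooth_on_coord _ _ _ _ _ id) => //; [exact: openT|exact: smooth_on_id].
have sk' := smooth_on_sub WU (@smooth_on_fst _ _ 'rV[R]_2 _ _ _ sk).
have se' := smooth_on_sub WU (@smooth_on_fst _ _ 'rV[R]_2 _ _ _ se).
have sf' := smooth_on_sub WU (@smooth_on_fst _ _ 'rV[R]_2 _ _ _ sf).
have c1 (c : R) : smooth_on W (fun=> c : R) by exact: smooth_on_cst.
apply: smooth_on_pair => //.
  exact: (smooth_on_sub (@subsetT _ _) (@smooth_on_fst _ _ _ _ setT id (@smooth_on_id _ _ _))).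
apply: smooth_onD => //.
  apply: smooth_onZ => //; last exact: smooth_outer.
  apply: smooth_onV => //; last exact: smooth_on_ev.
  by move=> z [/k0 kz _]; exact: lt0r_neq0 (ev_gt0 kz).
apply: smooth_onZ => //.
  by apply: smooth_onV => //; [move=> z []|exact: smooth_on_sub WU smooth_den].
apply: smooth_onD => //.
  apply: smooth_onD => //.
    apply: smooth_onZ => //; last exact: smooth_outer.
    by apply: smooth_onM => //; apply: smooth_onD.
  apply: smooth_onZ => //; first exact: smooth_onM.
  by apply: smooth_onD => //; exact: smooth_outer.
apply: smooth_onZ => //; last exact: smooth_outer.
by apply: smooth_onM => //; apply: smooth_onD => //; exact: smooth_onN.
Qed.

Lemma smooth_N (a b : E -> E) : smooth_on U a -> smooth_on U b ->
  (forall x, U x -> a x != 0) -> (forall x, U x -> b x != 0) ->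
  smooth_on (fst @^-1` U) (fun y : E * 'M[R]_8 =>
    ev (a y.1 *m y.2) (b y.1) / (ev (a y.1) (a y.1) * ev (b y.1) (b y.1))).
Proof.
move=> sa sb a0 b0.
have oW : open (fst @^-1` U : set (E * 'M[R]_8)) by exact: open_fst.
have sa' := @smooth_on_fst _ _ 'M[R]_8 _ _ _ sa.
have sb' := @smooth_on_fst _ _ 'M[R]_8 _ _ _ sb.
have s2 i j : smooth_on (fst @^-1` U) (fun z : E * 'M[R]_8 => z.2 i j).
  apply: (smooth_on_sub (@subsetT _ _)).
  apply: (@smooth_on_snd _ _ _ _ setT (fun u : 'M[R]_8 => u i j)).
  by apply: (@smooth_on_coord _ _ _ _ _ id) => //; [exact: openT|exact: smooth_on_id].
apply: smooth_onM => //.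
  apply: smooth_on_ev => //; apply: smooth_on_mx => // i j.
  apply: (smooth_on_eq oW _ (@smooth_on_sum _ _ _ _ _ (index_enum 'I_8)
    (fun l (y : E * 'M[R]_8) => a y.1 0 l * y.2 l j) oW _)) => [y _|l].
    by rewrite ord1 mxE.
  by apply: smooth_onM => //; exact: smooth_on_coord.
apply: smooth_onV => //; last by apply: smooth_onM => //; exact: smooth_on_ev.
by move=> y Uy; rewrite mulf_neq0// lt0r_neq0// ev_gt0// ?a0 ?b0.
Qed.

Lemma open_chart_inv_dom : open (fst @^-1` U `&` [set y | Nee y + Nff y != 0]).
Proof.
have oW : open (fst @^-1` U : set (E * 'M[R]_8)) by exact: open_fst.
apply: open_neq0_on => // y Uy.
have s : smooth_on (fst @^-1` U) (fun y => Nee y + Nff y).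
  by apply: smooth_onD => //; exact: smooth_N.
exact: smooth_on_diff s Uy.
Qed.

Lemma smooth_chart_inv :
  smooth_on (fst @^-1` U `&` [set y | Nee y + Nff y != 0]) chart_inv.
Proof.
set W := _ `&` _; have oW : open W by exact: open_chart_inv_dom.
have WU : W `<=` fst @^-1` U by move=> z [].
have s11 := smooth_on_sub WU (smooth_N se se e0 e0).
have s22 := smooth_on_sub WU (smooth_N sf sf f0 f0).
have s12 := smooth_on_sub WU (smooth_N se sf e0 f0).
have sV : smooth_on W (fun y => (Nee y + Nff y)^-1).
  by apply: smooth_onV => //; [move=> y []|exact: smooth_onD].
apply: smooth_on_pair => //.
  exact: (smooth_on_sub (@subsetT _ _) (@smooth_on_fst _ _ _ _ setT id (@smooth_on_id _ _ _))).
apply: smooth_onD => //; apply: smooth_onZl => //; apply: smooth_onM => //.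
  by apply: smooth_onD => //; exact: smooth_onN.
by apply: smooth_onM => //; exact: smooth_on_cst.
Qed.

Lemma chart_diffeo : diffeomorphism ((B `&` U) `*` @circle R)
  ((grass_embed (R := R) @` Sg) `&` fst @^-1` U) chart.
Proof.
exists chart_inv; split.
(* In both directions the local smooth extension is the rational formula itself, on the open set
   where its denominator is non-zero. *)
- move=> [x u] [/= [Bx Ux] cu]; exists (fst @^-1` U `&` [set z | chart_den z != 0]), chart.
  have [al [be [r0 cE sE]]] := half_angle cu.
  have [d0 _] := chartE Ux r0 cE sE.
  by split=> //; [split; [exact: open_chart_dom|split]|exact: smooth_chart].
- move=> _ [[[x V] SgV <-] /= Ux].
  exists (fst @^-1` U `&` [set y | Nee y + Nff y != 0]), chart_inv.
  have Bx := SgB SgV; have [VD dV kV] := (SgP V Bx Ux).1 SgV.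
  have [al [be [r0 VE]]] := plane_dir Ux VD dV kV.
  have [N0 _ _] := chart_invE Ux r0; rewrite -VE in N0.
  by split=> //; [split; [exact: open_chart_inv_dom|split]|exact: smooth_chart_inv].
- move=> [x u] [/= [Bx Ux] cu].
  have [al [be [r0 cE sE]]] := half_angle cu.
  have [_ ->] := chartE Ux r0 cE sE; split.
    by split=> //; exists (x, <<[:: k x; dir x al be]>>%VS) => //; exact: dir_plane.
  have [_ c' s'] := chart_invE Ux r0; congr pair.
  apply/rowP => i; apply: (mulIf r0).
  have [->|->] : i = 0 \/ i = 1.
    by case: i => -[|[|//]] h; [left|right]; exact: val_inj.
  + by rewrite cE -c'.
  + by rewrite sE -s'.
- move=> _ [[[x V] SgV <-] /= Ux].
  have Bx := SgB SgV; have [VD dV kV] := (SgP V Bx Ux).1 SgV.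
  have [al [be [r0 VE]]] := plane_dir Ux VD dV kV.
  have [_ c' s'] := chart_invE Ux r0; rewrite /grass_embed /= VE.
  have [_ H] := chartE Ux r0 c' s'; split; last exact: H.
  split; first by split.
  exact: circle_double_angle r0 c' s'.
Qed.

End CircleChart.

(** * Frames adapted to the kernel line *)

Section GramSchmidt.
Context {R : realType}.
Local Notation E := 'rV[R]_8.
Implicit Types (k a b e f : E) (U : set E).

Definition orth1 k a : E := a - (ev a k / ev k k) *: k.
Definition orth2 k a b : E := orth1 k b - (ev b (orth1 k a) / ev (orth1 k a) (orth1 k a)) *: orth1 k a.

(** Non-vanishing comes from a dimension count: the span of the new triple contains the old one, of
    dimension 3, so the new triple is free. *)
Lemma gram_schmidt k a b : free [:: k; a; b] ->
  [/\ [/\ k != 0, orth1 k a != 0 & orth2 k a b != 0],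
      [/\ ev k (orth1 k a) = 0, ev k (orth2 k a b) = 0 &
          ev (orth1 k a) (orth2 k a b) = 0] &
      <<[:: k; orth1 k a; orth2 k a b]>>%VS = <<[:: k; a; b]>>%VS].
Proof.
move=> fr; set e := orth1 k a; set f := orth2 k a b.
have mk : k \in <<[:: k; e; f]>>%VS by apply: memv_span; rewrite inE eqxx.
have me : e \in <<[:: k; e; f]>>%VS by apply: memv_span; rewrite !inE eqxx orbT.
have mf : f \in <<[:: k; e; f]>>%VS by apply: memv_span; rewrite !inE eqxx !orbT.
(* This and [mb] hold whatever the quotients are, so the spans can be compared before the
   denominators are known to be non-zero. *)
have ma : a \in <<[:: k; e; f]>>%VS.
  have -> : a = e + (ev a k / ev k k) *: k by rewrite /e /orth1 subrK.
  by rewrite memvD// memvZ.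
have mb : b \in <<[:: k; e; f]>>%VS.
  have -> : b = f + (ev b e / ev e e) *: e + (ev b k / ev k k) *: k.
    by rewrite /f /orth2 subrK /orth1 subrK.
  exact: memvD (memvD mf (memvZ _ me)) (memvZ _ mk).
have sub : (<<[:: k; a; b]>> <= <<[:: k; e; f]>>)%VS.
  by apply/span_subvP => x; rewrite !inE => /or3P[] /eqP->.
have d3 : \dim <<[:: k; a; b]>> = 3%N by move/eqP: fr.
have dle : (\dim <<[:: k; e; f]>> <= 3)%N by exact: dim_span.
have eqs : <<[:: k; a; b]>>%VS = <<[:: k; e; f]>>%VS.
  by apply/eqP; rewrite eqEdim sub d3.
have fr' : free [:: k; e; f] by rewrite /free -eqs d3.
have k0 : k != 0 by apply: (free_not0 fr'); rewrite inE eqxx.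
have e0 : e != 0 by apply: (free_not0 fr'); rewrite !inE eqxx orbT.
have f0 : f != 0 by apply: (free_not0 fr'); rewrite !inE eqxx !orbT.
have kk := lt0r_neq0 (ev_gt0 k0); have ee := lt0r_neq0 (ev_gt0 e0).
have o1 c : ev k (orth1 k c) = 0.
  by rewrite /orth1 evBr evZr divfK// evC subrr.
split; [by []| |by []]; split; [exact: o1| |].
  by rewrite /f /orth2 evBr evZr !o1 mulr0 subrr.
rewrite /f /orth2 -/e evBr evZr divfK// /orth1 evBr evZr (evC e k) /e o1.
by rewrite mulr0 subr0 evC subrr.
Qed.

Lemma smooth_orth1 U (k a : E -> E) : open U -> (forall x, U x -> k x != 0) ->
  smooth_on U k -> smooth_on U a -> smooth_on U (fun x => orth1 (k x) (a x)).
Proof.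
move=> oU k0 sk sa; apply: smooth_onD => //; apply: smooth_onNmx => //.
apply: smooth_onZ => //; apply: smooth_onM => //; first exact: smooth_on_ev.
apply: smooth_onV => //; last exact: smooth_on_ev.
by move=> x Ux; rewrite lt0r_neq0// ev_gt0// k0.
Qed.

Lemma smooth_orth2 U (k a b : E -> E) : open U -> (forall x, U x -> k x != 0) ->
  (forall x, U x -> orth1 (k x) (a x) != 0) ->
  smooth_on U k -> smooth_on U a -> smooth_on U b ->
  smooth_on U (fun x => orth2 (k x) (a x) (b x)).
Proof.
move=> oU k0 e0 sk sa sb; have se := smooth_orth1 oU k0 sk sa.
apply: smooth_onD => //; first exact: smooth_orth1.
apply: smooth_onNmx => //; apply: smooth_onZ => //.
apply: smooth_onM => //; first exact: smooth_on_ev.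
apply: smooth_onV => //; last exact: smooth_on_ev.
by move=> x Ux; rewrite lt0r_neq0// ev_gt0// e0.
Qed.

End GramSchmidt.

Lemma solve_coef (K : fieldType) (l m p q : K) :
  m != 0 -> l * p + m * q = 0 -> q = - (l / m) * p.
Proof.
move=> m0 /eqP; rewrite addrC addr_eq0 => /eqP mq.
by apply: (mulfI m0); rewrite mq mulrA mulrN mulrCA divff// mulr1 mulNr.
Qed.

Section ExchangeBasis.
Context {K : fieldType} {L : vectType K}.
Implicit Types (e : L).

(** Steinitz exchange: the combination may replace a frame vector whose coefficient in it is
    non-zero. *)
Lemma exchange2 e1 e2 e3 (a b c : K) : free [:: e1; e2; e3] -> b != 0 ->
  <<[:: lincomb e1 e2 e3 a b c; e1; e3]>>%VS = <<[:: e1; e2; e3]>>%VS /\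
  free [:: lincomb e1 e2 e3 a b c; e1; e3].
Proof.
move=> fr b0; set k := lincomb _ _ _ _ _ _; set W := <<[:: k; _; _]>>%VS.
have mk : k \in W by apply: memv_span; rewrite inE eqxx.
have m1 : e1 \in W by apply: memv_span; rewrite !inE eqxx orbT.
have m3 : e3 \in W by apply: memv_span; rewrite !inE eqxx !orbT.
have m2 : e2 \in W.
  have -> : e2 = b^-1 *: (k - a *: e1 - c *: e3).
    by rewrite /k /lincomb addrAC addrK addrAC subrr add0r scalerK.
  by rewrite memvZ// !memvB// memvZ.
have sub : (<<[:: e1; e2; e3]>> <= W)%VS.
  by apply/span_subvP => x; rewrite !inE => /or3P[] /eqP->.
have d3 : \dim <<[:: e1; e2; e3]>> = 3%N by move/eqP: fr.
have dle : (\dim W <= 3)%N by exact: dim_span.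
have eqs : <<[:: e1; e2; e3]>>%VS = W by apply/eqP; rewrite eqEdim sub d3.
by split; [rewrite eqs|rewrite /free -/W -eqs d3].
Qed.

Lemma exchange1 e1 e2 e3 (a b c : K) : free [:: e1; e2; e3] -> a != 0 ->
  <<[:: lincomb e1 e2 e3 a b c; e2; e3]>>%VS = <<[:: e1; e2; e3]>>%VS /\
  free [:: lincomb e1 e2 e3 a b c; e2; e3].
Proof.
move=> fr a0; set k := lincomb _ _ _ _ _ _; set W := <<[:: k; _; _]>>%VS.
have mk : k \in W by apply: memv_span; rewrite inE eqxx.
have m2 : e2 \in W by apply: memv_span; rewrite !inE eqxx orbT.
have m3 : e3 \in W by apply: memv_span; rewrite !inE eqxx !orbT.
have m1 : e1 \in W.
  have -> : e1 = a^-1 *: (k - b *: e2 - c *: e3).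
    by rewrite /k /lincomb addrAC addrK addrK scalerK.
  by rewrite memvZ// !memvB// memvZ.
have sub : (<<[:: e1; e2; e3]>> <= W)%VS.
  by apply/span_subvP => x; rewrite !inE => /or3P[] /eqP->.
have d3 : \dim <<[:: e1; e2; e3]>> = 3%N by move/eqP: fr.
have dle : (\dim W <= 3)%N by exact: dim_span.
have eqs : <<[:: e1; e2; e3]>>%VS = W by apply/eqP; rewrite eqEdim sub d3.
by split; [rewrite eqs|rewrite /free -/W -eqs d3].
Qed.

End ExchangeBasis.

(** * The prolongation for independent and for proportional forms *)

Section Prolongation.
Context {R : realType}.
Local Notation E := 'rV[R]_8.
Variables F G : E -> R.
Hypotheses (sF : smooth_on setT F) (sG : smooth_on setT G).
Hypothesis reg : forall w, locus F G w -> regpts F G w.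
Implicit Types (u v w x : E) (V : {vspace E}).

Local Notation f := (grad F).
Local Notation g := (grad G).
Local Notation e1 w := (X1 (f w) (g w) w).
Local Notation e2 w := (X2 (f w) (g w) w).
Local Notation e3 w := (vY (f w) (g w)).
Local Notation D w := <<[:: e1 w; e2 w; e3 w]>>%VS.
Local Notation nr w := (nr (f w) (g w)).
Local Notation ns w := (ns (f w) (g w)).
Local Notation nt w := (nt (f w) (g w)).
Local Notation ker1 w := (kervec (extd (@varpi1 R) w) (e1 w) (e2 w) (e3 w)).
Local Notation ker2 w := (kervec (extd (@varpi2 R) w) (e1 w) (e2 w) (e3 w)).

Lemma rank_two_trivial : (forall w, locus F G w -> rank_two F G w) ->
  trivial_prolongation F G.
Proof.
move=> r2.
have SE w V : locus F G w -> Sigma F G (w, V) <-> V = <<[:: ker1 w; ker2 w]>>%VS.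
  move=> lw; have rw := reg lw; apply: iff_trans (SigmaP sF sG rw V lw) _.
  exact: (unique_plane (altform_varpi1 w) (altform_varpi2 w) (frame_free rw) V (r2 w lw)).
split.
- by move=> [w V] [].
- move=> [w V] [w' V'] /set_mem S1 /set_mem S2 /= ww'; move: S1 S2; rewrite -ww' => S1 S2.
  have lw : locus F G w by case: S1.
  by rewrite ((SE w V lw).1 S1) ((SE w V' lw).1 S2).
- move=> w lw; exists (w, <<[:: ker1 w; ker2 w]>>%VS) => //.
  exact/(SE _ _ lw).
Qed.

(** Evaluating the relation on (X1, Y) and (X2, Y) shows that the symmetric matrix with rows (nr,
    ns) and (ns, nt) kills (l, m). Hence nr != 0 forces m != 0 and the second form is a multiple of
    the first; nt != 0 exchanges the roles. If nr = nt = 0 then ns != 0 by regularity, and the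
    matrix would be invertible. *)
Lemma rank_one_planes w : locus F G w -> rank_one F G w -> [/\
  nr w != 0 -> forall V, Sigma F G (w, V) <->
    [/\ (V <= D w)%VS, \dim V = 2%N & ker1 w \in V],
  nt w != 0 -> forall V, Sigma F G (w, V) <->
    [/\ (V <= D w)%VS, \dim V = 2%N & ker2 w \in V] &
  nr w != 0 \/ nt w != 0].
Proof.
move=> lw [l [m [lm E0]]]; have rw := reg lw.
have a1 := altform_varpi1 w; have a2 := altform_varpi2 w; have fr := frame_free rw.
have [b23 b13] := frame_varpi1 F G w; have [c23 c13] := frame_varpi2 F G w.
have m1 : e1 w \in D w by apply: memv_span; rewrite !inE eqxx.
have m2 : e2 w \in D w by apply: memv_span; rewrite !inE eqxx orbT.
have m3 : e3 w \in D w by apply: memv_span; rewrite !inE eqxx !orbT.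
have E13 : l * nr w + m * ns w = 0 by rewrite -b13 -c13; exact: E0.
have E23 : l * ns w + m * nt w = 0 by rewrite -b23 -c23; exact: E0.
have lm0 : ~ (l = 0 /\ m = 0) by move=> [l0 m0]; move/eqP: lm; apply; rewrite l0 m0.
split.
- move=> r0 V; have mn0 : m != 0.
    apply/eqP => m0; apply: lm0; split=> //; apply: (mulIf r0).
    by move: E13; rewrite m0 !mul0r addr0.
  have k0 : ker1 w != 0.
    apply/eqP => /(frame_comb0 fr)[_ /eqP]; rewrite oppr_eq0 b13 => /eqP h _.
    by rewrite h eqxx in r0.
  apply: iff_trans (SigmaP sF sG rw V lw) _.
  apply: (line_of_planes a1 fr (t := - (l / m)) V k0) => u v uD vD.
  exact: solve_coef mn0 (E0 u v uD vD).
- move=> t0 V; have ln0 : l != 0.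
    apply/eqP => l0; apply: lm0; split=> //; apply: (mulIf t0).
    by move: E23; rewrite l0 !mul0r add0r.
  have k0 : ker2 w != 0.
    by apply/eqP => /(frame_comb0 fr)[+ _ _]; rewrite c23 => h; rewrite h eqxx in t0.
  apply: iff_trans (SigmaP sF sG rw V lw) _.
  have K u v : u \in D w -> v \in D w ->
      extd (@varpi1 R) w u v = - (m / l) * extd (@varpi2 R) w u v.
    by move=> uD vD; have := E0 u v uD vD; rewrite addrC => E1; exact: solve_coef ln0 E1.
  have [H1 H2] := line_of_planes a2 fr V k0 K.
  split=> [[VD dV b1 b2]|VP]; first exact: H1 (And4 VD dV b2 b1).
  by have [VD dV b2 b1] := H2 VP; exact: And4 VD dV b1 b2.
- have [r0|] := eqVneq (nr w) 0; last by left.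
  have [t0|] := eqVneq (nt w) 0; last by right.
  exfalso; move: E13 E23; rewrite r0 t0 !mulr0 add0r addr0.
  have s0 : ns w != 0.
    apply: contraNneq rw => s0; rewrite /nn.
    by move: r0 s0 t0 => -> -> ->; rewrite expr0n !addr0.
  move=> /eqP; rewrite mulf_eq0 (negbTE s0) orbF => /eqP m0.
  by move=> /eqP; rewrite mulf_eq0 (negbTE s0) orbF => /eqP l0; apply: lm0.
Qed.

Lemma smooth_kervec U (be : E -> E -> E -> R) : open U -> U `<=` regpts F G ->
  (forall a b : E -> E, smooth_on U a -> smooth_on U b ->
     smooth_on U (fun x => be x (a x) (b x))) ->
  smooth_on U (fun x => kervec (be x) (e1 x) (e2 x) (e3 x)).
Proof.
move=> oU Ureg sb.
have s1 := smooth_on_sub Ureg (smooth_X1 sF sG).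
have s2 := smooth_on_sub Ureg (smooth_X2 sF sG).
have s3 := smooth_on_sub Ureg (smooth_vY sF sG).
apply: smooth_onD => //; last by apply: smooth_onZ => //; exact: sb.
apply: smooth_onD => //; apply: smooth_onZ => //; first exact: sb.
by apply: smooth_onN => //; exact: sb.
Qed.

Lemma smooth_extd_varpi U (a b : E -> E) : open U -> smooth_on U a -> smooth_on U b ->
  smooth_on U (fun x => extd (@varpi1 R) x (a x) (b x)) /\
  smooth_on U (fun x => extd (@varpi2 R) x (a x) (b x)).
Proof.
move=> oU sa sb.
have H (i j k l : 'I_8) : smooth_on U (fun x => b x 0 i * a x 0 k + b x 0 j * a x 0 l -
    (a x 0 i * b x 0 k + a x 0 j * b x 0 l)).
  have sai n : smooth_on U (fun x => a x 0 n) by exact: smooth_on_coord.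
  have sbi n : smooth_on U (fun x => b x 0 n) by exact: smooth_on_coord.
  apply: smooth_onD => //; last apply: smooth_onN => //.
    by apply: smooth_onD => //; exact: smooth_onM.
  by apply: smooth_onD => //; exact: smooth_onM.
split.
  by apply: (smooth_on_eq oU _ (H ir is_ ix iy)) => x _; rewrite extd_varpi1.
by apply: (smooth_on_eq oU _ (H is_ it ix iy)) => x _; rewrite extd_varpi2.
Qed.

(** The choice of form made at b remains valid on an open set. The kernel vector of the first has
    coefficient -nr on [X2] and replaces it; that of the second has coefficient nt on [X1] and
    replaces that. *)
Lemma rank_one_frame b : (forall w, locus F G w -> rank_one F G w) -> locus F G b ->
  exists (U : set E) (k a c : E -> E),
  [/\ open_nbhs b U, [/\ smooth_on U k, smooth_on U a & smooth_on U c],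
      (forall x, U x -> free [:: k x; a x; c x]) &
      (forall x V, locus F G x -> U x -> Sigma F G (x, V) <->
        [/\ (V <= <<[:: k x; a x; c x]>>)%VS, \dim V = 2%N & k x \in V])].
Proof.
move=> r1 lb; have rb := reg lb.
have oreg := open_regpts sF sG.
have [sr ss st] := smooth_nrst sF sG oreg.
have [_ _ [r0|t0]] := rank_one_planes lb (r1 b lb).
  pose U := regpts F G `&` [set x | nr x != 0].
  have oU : open U by apply: open_neq0_on => // x rx; exact: smooth_on_diff sr rx.
  have UR : U `<=` regpts F G by move=> x [].
  have ex x : U x -> <<[:: ker1 x; e1 x; e3 x]>>%VS = D x /\
      free [:: ker1 x; e1 x; e3 x].
    move=> [rx rx0]; apply: exchange2 (frame_free rx) _.
    by rewrite (frame_varpi1 F G x).2 oppr_eq0.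
  exists U, (fun x => ker1 x), (fun x => e1 x), (fun x => e3 x); split.
  - by split.
  - split; [|exact: smooth_on_sub UR (smooth_X1 sF sG)|
      exact: smooth_on_sub UR (smooth_vY sF sG)].
    by apply: smooth_kervec => // p q sp sq; have [] := smooth_extd_varpi oU sp sq.
  - by move=> x /ex[].
  - move=> x V lx Ux; rewrite (ex x Ux).1.
    by have [H _ _] := rank_one_planes lx (r1 x lx); apply: H; case: Ux.
pose U := regpts F G `&` [set x | nt x != 0].
have oU : open U by apply: open_neq0_on => // x rx; exact: smooth_on_diff st rx.
have UR : U `<=` regpts F G by move=> x [].
have ex x : U x -> <<[:: ker2 x; e2 x; e3 x]>>%VS = D x /\
    free [:: ker2 x; e2 x; e3 x].
  move=> [rx rx0]; apply: exchange1 (frame_free rx) _.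
  by rewrite (frame_varpi2 F G x).1.
exists U, (fun x => ker2 x), (fun x => e2 x), (fun x => e3 x); split.
- by split.
- split; [|exact: smooth_on_sub UR (smooth_X2 sF sG)|
    exact: smooth_on_sub UR (smooth_vY sF sG)].
  by apply: smooth_kervec => // p q sp sq; have [] := smooth_extd_varpi oU sp sq.
- by move=> x /ex[].
- move=> x V lx Ux; rewrite (ex x Ux).1.
  by have [_ H _] := rank_one_planes lx (r1 x lx); apply: H; case: Ux.
Qed.

(** The planes spanned by k with a and by k with c are both integral over b; were they equal, three
    independent vectors would lie in one plane. *)
Lemma rank_one_nontrivial : (forall w, locus F G w -> rank_one F G w) ->
  locus F G !=set0 -> ~ trivial_prolongation F G.
Proof.
move=> r1 [b lb] [_ inj _].
have [U [k [a [c [[oU Ub] _ fr SP]]]]] := rank_one_frame r1 lb.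
have frb := fr b Ub.
have S (z : E) : z \in [:: a b; c b] -> free [:: k b; z] ->
    Sigma F G (b, <<[:: k b; z]>>%VS).
  move=> zac fz; apply/SP => //; split; last by apply: memv_span; rewrite inE eqxx.
    apply/span_subvP => y; rewrite !inE => /orP[] /eqP->; apply: memv_span.
      by rewrite inE eqxx.
    by rewrite inE zac orbT.
  by move/eqP: fz.
have fka : free [:: k b; a b] by exact: (@catl_free _ _ [:: c b] [:: k b; a b]).
have fkc : free [:: k b; c b].
  move: frb; rewrite (perm_free (Y := [:: a b; k b; c b])).
    by rewrite free_cons => /andP[].
  by rewrite (perm_catCA [:: k b] [:: a b]).
have /(congr1 snd) /= VV := inj _ _ (mem_set (S (a b) (mem_head _ _) fka))
  (mem_set (S (c b) (mem_last (a b) [:: c b]) fkc)) erefl.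
have sub : (<<[:: k b; a b; c b]>> <= <<[:: k b; a b]>>)%VS.
  apply/span_subvP => y; rewrite !inE => /or3P[] /eqP->.
  - by apply: memv_span; rewrite inE eqxx.
  - by apply: memv_span; rewrite !inE eqxx orbT.
  - by rewrite VV; apply: memv_span; rewrite !inE eqxx orbT.
have := dimvS sub; have /eqP -> := frb; have /eqP -> := fka.
by [].
Qed.

Lemma rank_one_circle_bundle : (forall w, locus F G w -> rank_one F G w) ->
  prolongation_circle_bundle F G.
Proof.
move=> r1; split.
- by move=> _ [[w V] [lw _] <-].
- move=> z _; exists setT, fst; split=> //.
    by split; [exact: openT|].
  exact: (@smooth_on_fst _ _ _ _ setT id (@smooth_on_id _ _ _)).
move=> b lb; have [U [k [a [c [[oU Ub] [sk sa sc] fr SP]]]]] := rank_one_frame r1 lb.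
(* Orthogonalisation keeps k and the span, so the description of the integral planes carries over to
   the orthogonal frame required by the circle chart. *)
pose e x := orth1 (k x) (a x); pose h x := orth2 (k x) (a x) (c x).
have gs x : U x -> _ := fun Ux => gram_schmidt (fr x Ux).
have k0 x : U x -> k x != 0 by move=> /gs[[]].
have e0 x : U x -> e x != 0 by move=> /gs[[]].
have h0 x : U x -> h x != 0 by move=> /gs[[]].
have ke x : U x -> ev (k x) (e x) = 0 by move=> /gs[_ []].
have kh x : U x -> ev (k x) (h x) = 0 by move=> /gs[_ []].
have eh x : U x -> ev (e x) (h x) = 0 by move=> /gs[_ []].
have se : smooth_on U e by exact: smooth_orth1.
have sh : smooth_on U h by exact: smooth_orth2.
have SP' x V : locus F G x -> U x -> Sigma F G (x, V) <->
    [/\ (V <= <<[:: k x; e x; h x]>>)%VS, \dim V = 2%N & k x \in V].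
  by move=> lx Ux; have [_ _ ->] := gs x Ux; exact: SP.
exists U, (chart k e h); split.
- by split.
- apply: (chart_diffeo oU sk se sh k0 e0 h0 ke kh eh _ SP').
  by move=> x V [].
- by [].
Qed.

End Prolongation.

Theorem theorem3p9 (R : realType) (F G : 'rV[R]_8 -> R) (k : systype) :
  regular_overdetermined F G ->
  of_type F G k ->
  [/\ (k = TypeI -> ~ trivial_prolongation F G),
      ((k = TypeII \/ k = TypeIII \/ k = TypeIV) -> trivial_prolongation F G) &
      (k = TypeI -> prolongation_circle_bundle F G)].
Proof.
move=> [sF sG ne rf] ty.
have reg w : locus F G w -> regpts F G w by move=> lw; exact/symbol_regpts/rf.
have r1 : k = TypeI -> forall w, locus F G w -> rank_one F G w.
  by move=> kE w lw; rewrite kE in ty; exact: (type_rank_one sF sG lw (reg w lw) ty).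
split.
- by move=> /r1 H; exact: (rank_one_nontrivial sF sG reg H ne).
- move=> kE; apply: (rank_two_trivial sF sG reg) => w lw.
  apply: (type_rank_two sF sG lw (reg w lw) ty).
  by case: kE => [->|[->|->]].
- by move=> /r1 H; exact: (rank_one_circle_bundle sF sG reg H).
Qed.
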